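(* Let $n$ be a positive integer, $1\le k\le n$, $w\in\mathfrak S_n$. The map $\mathrm{Rev}_{n,k,w}:\mathcal B_w(n,k)\to\mathcal C_w(n,k+1)$, $[\rho]\mapsto\mathrm{Rev}_{n,k,w}(\rho)$, is a well-defined poset isomorphism, and its inverse sends $R\in\mathcal C_w(n,k+1)$ to the set $\mathscr L(\mathrm{Inv}_k(w),\le_R)$ of linear extensions of $(\mathrm{Inv}_k(w),\le_R)$ (which is a single commutation class).
   Context: $\mathfrak S_n$ is the symmetric group on $[n]$. For $m\ge0$, $\binom{[n]}{m}$ is the set of $m$-subsets of $[n]$ written $[x_1,\dots,x_m]$ with $x_1<\dots<x_m$; $X_i$ is $X$ with $x_i$ removed; $P(X)=\{X_1,\dots,X_m\}$ with lex order $(X_m,\dots,X_1)$ and antilex order $(X_1,\dots,X_m)$; a prefix is a set $\{X_m,\dots,X_i\}$, a suffix a set $\{X_i,\dots,X_1\}$ (empty set counts as both). $\mathrm{Inv}_m(w)=\{[x_1,\dots,x_m]\in\binom{[n]}{m}:w^{-1}(x_1)>\dots>w^{-1}(x_m)\}$. $X$ is an $m$-quasi-inversion if exactly one pair $[x_a,x_b]$, $a<b$, is not in $\mathrm{Inv}_2(w)$. Quasi-inversion relations on $\mathrm{Inv}_m(w)$: for a quasi-inversion $X\in\binom{[n]}{m+1}$ with $P(X)\cap\mathrm{Inv}_m(w)=\{X_i,X_{i+1}\}$, $X_i<X_{i+1}$ if $m-i$ is odd, $X_{i+1}<X_i$ if $m-i$ is even; $\mathcal P_w(n,m)$ is the reflexive-transitive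 closure on $\mathrm{Inv}_m(w)$. $\mathcal A_w(n,k)$: total orders $\rho$ of $\mathrm{Inv}_k(w)$ that are linear extensions of $\mathcal P_w(n,k)$ with $\rho|_{P(X)}$ lex or antilex for every $X\in\mathrm{Inv}_{k+1}(w)$. $\mathrm{Rev}_{n,k,w}(\rho)=\{X\in\mathrm{Inv}_{k+1}(w):\rho|_{P(X)}=(X_1,\dots,X_{k+1})\}$. Elements of $\mathrm{Inv}_k(w)$ commute if incomparable in $\mathcal P_w(n,k)$ and not both in some packet $P(Z)$, $Z\in\binom{[n]}{k+1}$; $\sim_w$ is generated by swapping adjacent commuting elements. For $X\in\mathrm{Inv}_{k+1}(w)$ whose packet occupies consecutive positions of $\rho$ in lex order, the lex-to-antilex packet flip reverses that block. $\mathcal B_w(n,k)$ is the poset on $\mathcal A_w(n,k)/\!\sim_w$ with $[\rho]\le[\sigma]$ iff $\sigma$ is obtained from $\rho$ by commutations and lex-to-antilex packet flips. $R\subseteq\mathrm{Inv}_{m}(w)$ is consistent if it is a lower ideal of $\mathcal P_w(n,m)$ and $P(X)\cap R$ is a prefix or suffix of $P(X)$ for all $X\in\mathrm{Inv}_{m+1}(w)$; $\mathcal C_w(n,m)$ is the set of consistent sets ordered by $R\le R'$ iff there is a chain of consistent sets $R=R_0\subset\dots\subset R_t=R'$ with $|R_{j+1}\setminus R_j|=1$. For $R\in\mathcal C_w(n,k+1)$, $G_R$ is the directed graph on $\mathrm{Inv}_k(w)$ with edges $X\to Y$ for each quasi-inversion relation $X<Y$ on $\mathrm{Inv}_k(w)$,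 $X_i\to X_{i+1}$ ($1\le i\le k$) for $X\in R$, and $X_{i+1}\to X_i$ ($1\le i\le k$) for $X\in\mathrm{Inv}_{k+1}(w)\setminus R$. $G_R$ is acyclic, and $\le_R$ denotes the partial order on $\mathrm{Inv}_k(w)$ given by its reflexive-transitive closure. *)

(* Defs.v *)
From Stdlib Require Import Relations.
From mathcomp Require Import all_boot all_fingroup.
Set Implicit Arguments. Unset Strict Implicit. Unset Printing Implicit Defensive.

Section Defs.
Variables (n : nat) (w : {perm 'I_n}).

Local Notation T := {set 'I_n}.

Definition elems (X : T) : seq 'I_n := sort (fun a b : 'I_n => (a <= b)%N) (enum X).

Definition del (X : T) (i : nat) : T := [set x in X | index x (elems X) != i.-1].

Definition lex (X : T) : seq T := [seq del X i | i <- rev (iota 1 #|X|)].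
Definition antilex (X : T) : seq T := [seq del X i | i <- iota 1 #|X|].
(* membership in the packet P(X) is  Y \in antilex X *)

Definition winv (a : 'I_n) : nat := val ((w^-1)%g a).

Definition Inv (m : nat) (X : T) : bool :=
  (#|X| == m) && sorted (fun a b : 'I_n => (winv b < winv a)%N) (elems X).

(* [a,b] in Inv_2(w), for a < b *)
Definition inv2 (a b : 'I_n) : bool := (winv b < winv a)%N.

Definition quasi_inv (X : T) : bool :=
  #|[set p : 'I_n * 'I_n | [&& p.1 \in X, p.2 \in X, (p.1 < p.2)%N & ~~ inv2 p.1 p.2]]| == 1.

Definition qrel (m : nat) (X Y : T) : bool :=
  [exists Z : T, [exists i : 'I_m.+1,
    [&& #|Z| == m.+1, quasi_inv Z, (0 < i)%N,
        [set W in antilex Z | Inv m W] == [set del Z i; del Z i.+1] &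
        (if odd (m - i) then (X == del Z i) && (Y == del Z i.+1)
         else (X == del Z i.+1) && (Y == del Z i))]]].

(* P_w(n,m): reflexive-transitive closure (used on Inv_m(w)) *)
Definition Ple (m : nat) (X Y : T) : bool := connect (qrel m) X Y.

(* rho is a total order (listed increasingly) of Inv_k(w) *)
Definition total_order_of (k : nat) (rho : seq T) : Prop :=
  uniq rho /\ forall X, (X \in rho) = Inv k X.

Definition respects (le : T -> T -> bool) (rho : seq T) : Prop :=
  forall X Y, X \in rho -> Y \in rho -> le X Y -> (index X rho <= index Y rho)%N.

Definition restr (rho : seq T) (X : T) : seq T := [seq Y <- rho | Y \in antilex X].

Definition Aset (k : nat) (rho : seq T) : Prop :=
  [/\ total_order_of k rho, respects (Ple k) rho &
      forall X, Inv k.+1 X -> restr rho X = lex X \/ restr rho X = antilex X].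

Definition Rev (k : nat) (rho : seq T) : {set T} :=
  [set X | Inv k.+1 X & restr rho X == antilex X].

Definition commuting (k : nat) (X Y : T) : bool :=
  [&& ~~ Ple k X Y, ~~ Ple k Y X &
      ~~ [exists Z : T, [&& #|Z| == k.+1, X \in antilex Z & Y \in antilex Z]]].

Definition comm_step (k : nat) (rho sigma : seq T) : Prop :=
  exists s1 s2 X Y, [/\ commuting k X Y, rho = s1 ++ X :: Y :: s2 &
                        sigma = s1 ++ Y :: X :: s2].

Definition flip_step (k : nat) (rho sigma : seq T) : Prop :=
  exists s1 s2 X, [/\ Inv k.+1 X, rho = s1 ++ lex X ++ s2 &
                      sigma = s1 ++ antilex X ++ s2].

Definition comm_equiv (k : nat) : relation (seq T) :=
  clos_refl_sym_trans _ (fun rho sigma => [/\ Aset k rho, Aset k sigma & comm_step k rho sigma]).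

(* order of B_w(n,k), on representatives *)
Definition Ble (k : nat) : relation (seq T) :=
  clos_refl_trans _ (fun rho sigma =>
    [/\ Aset k rho, Aset k sigma & comm_step k rho sigma \/ flip_step k rho sigma]).

Definition consistent (m : nat) (R : {set T}) : bool :=
  [&& [forall X : T, (X \in R) ==> Inv m X],
      [forall X : T, [forall Y : T, [&& X \in R, Inv m Y & Ple m Y X] ==> (Y \in R)]] &
      [forall X : T, Inv m.+1 X ==>
         (let s := [seq Y <- lex X | Y \in R] in prefix s (lex X) || suffix s (lex X))]].

Definition C_step (m : nat) (R R' : {set T}) : bool :=
  [&& consistent m R, consistent m R', R \proper R' & #|R' :\: R| == 1].

Definition Cle (m : nat) (R R' : {set T}) : bool := connect (C_step m) R R'.

Definition Gedge (k : nat) (R : {set T}) (X Y : T) : bool :=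
  qrel k X Y ||
  [exists Z : T, [exists i : 'I_k.+1,
    [&& Inv k.+1 Z, (0 < i)%N &
      ((Z \in R) && (X == del Z i) && (Y == del Z i.+1)) ||
      ((Z \notin R) && (X == del Z i.+1) && (Y == del Z i))]]].

Definition leR (k : nat) (R : {set T}) (X Y : T) : bool := connect (Gedge k R) X Y.

Definition lin_ext (k : nat) (R : {set T}) (rho : seq T) : Prop :=
  total_order_of k rho /\ respects (leR k R) rho.

End Defs.

(* Main.v *)
(** Let [m] be the largest letter. For a consistent [R], the graph [G_R] has three
    layers: the sets [X] avoiding [m] with [m |: X] not in [R], then the sets
    containing [m], then the sets [X] avoiding [m] with [m |: X] in [R]. No edge
    goes back between layers. The outer layers are governed by the deletion of [m];
    the middle one is the reversed graph of the complement of the contraction,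
    because adding [m] changes the parity in the quasi-inversion relations.
    Induction on the ground set thus yields a rank function increasing along the
    edges of [G_R], hence linear extensions. Two of these are joined by adjacent
    swaps of incomparable elements, and incomparable elements commute since any
    two elements of a common packet are comparable.

    For the order, let [R] and [X |: R] be consistent. Ranks of both graphs show that
    no path leaves the packet of [X] and returns to it, so some linear extension has
    this packet as a block, and flipping the block realises the step. *)
Require Import Defs.
From Stdlib Require Import Relations.
From mathcomp Require Import all_boot all_fingroup zify.
Set Implicit Arguments. Unset Strict Implicit. Unset Printing Implicit Defensive.

(** * Deleting and adding single elements of finite sets *)

Lemma setD1C (T : finType) (Z : {set T}) a b : Z :\ a :\ b = Z :\ b :\ a.
Proof. by apply/setP=> z; rewrite !inE andbCA. Qed.

Lemma setU1D1 (T : finType) (Z : {set T}) m a :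
  a != m -> (m |: Z) :\ a = m |: (Z :\ a).
Proof.
move=> am; apply/setP=> z; rewrite !inE.
by case: (eqVneq z m) => [->|]; rewrite ?(eq_sym m) ?am.
Qed.

Lemma setD1_inj (T : finType) (Z : {set T}) a b :
  a \in Z -> Z :\ a = Z :\ b -> a = b.
Proof.
move=> aZ /setP/(_ a); rewrite !inE eqxx aZ !andbT /= => e.
by apply/eqP; rewrite -[a == b]negbK -e.
Qed.

(** * Acyclicity of [G_R] by induction on the ground set *)

Section Acyclic.
Variables (n : nat) (w : {perm 'I_n}).
Local Notation T := {set 'I_n}.
Local Notation wi := (winv w).
Implicit Types (X Y Z S : T) (x y a b c : 'I_n).

Lemma winv_inj : injective wi.
Proof. by move=> a b /val_inj/perm_inj. Qed.

Definition inversions Z := forall a b, a \in Z -> b \in Z -> a < b -> wi b < wi a.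

Definition quasi Z x y :=
  [/\ x \in Z, y \in Z, x < y, wi x < wi y &
     forall a b, a \in Z -> b \in Z -> a < b -> (a, b) != (x, y) -> wi b < wi a].

(** If [#|Z| = m + 1] and [y] is the element in position [i + 1], counted from 1, this number is
    [m - i]; its parity orients the quasi-inversion relations. *)
Definition above Z y := #|[set z in Z | y < z]|.

(** For [x < y], [true] is the antilex direction and [false] the lex direction. *)
Definition arrow (o : bool) Z x y X Y :=
  if o then X = Z :\ x /\ Y = Z :\ y else X = Z :\ y /\ Y = Z :\ x.

(* The relations are indexed by all pairs [x < y] of a packet, not only by the
   consecutive ones; no cardinality is fixed either. *)
Inductive edge S (R : {set T}) X Y : Prop :=
| EdgeQuasi Z x y of Z \subset S & quasi Z x y & arrow (odd (above Z y)) Z x y X Y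
| EdgeInv Z x y of Z \subset S & inversions Z & x \in Z & y \in Z & x < y
    & arrow (Z \in R) Z x y X Y.

(** Consistency relative to a ground set and without sizes, a form that passes to deletions and
    contractions. The second clause is the prefix-or-suffix condition, read on triples of a
    packet. *)
Definition coherent S (R : {set T}) :=
  (forall Z x y X Y, Z \subset S -> quasi Z x y ->
     arrow (odd (above Z y)) Z x y X Y -> Y \in R -> X \in R)
  /\ (forall Z a b c, Z \subset S -> inversions Z ->
     a \in Z -> b \in Z -> c \in Z -> a < b -> b < c ->
     (Z :\ a \in R) = (Z :\ c \in R) -> (Z :\ b \in R) = (Z :\ a \in R)).

(** * The three layers around the largest letter *)

Section Step.
Variables (S : T) (m : 'I_n).
Hypotheses (mS : m \in S) (mmax : forall s, s \in S -> s <= m).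
Let S1 := S :\ m.
(** The letters inverted with [m]; adding [m] to a subset keeps inversion sets and
    quasi-inversions. *)
Let S2 := [set s in S | (s < m) && (wi m < wi s)].

Lemma ltm Z z : Z \subset S1 -> z \in Z -> z < m.
Proof.
move=> /subsetP sZ /sZ; rewrite !inE => /andP[zm /mmax].
by rewrite leq_eqVlt => /orP[/eqP/val_inj zm'|//]; rewrite zm' eqxx in zm.
Qed.

Lemma S21 : S2 \subset S1.
Proof.
apply/subsetP=> z; rewrite !inE => /and3P[-> zm _]; rewrite andbT.
by apply: contraTneq zm => ->; rewrite ltnn.
Qed.

Lemma notinm Z : Z \subset S1 -> m \notin Z.
Proof. by move=> sZ; apply/negP=> /(ltm sZ); rewrite ltnn. Qed.

Lemma subU Z : Z \subset S1 -> m |: Z \subset S.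
Proof.
by move=> sZ; rewrite subUset sub1set mS (subset_trans sZ) ?subsetDl.
Qed.

Lemma inversionsU Z : Z \subset S2 -> inversions Z -> inversions (m |: Z).
Proof.
move=> sZ iZ a b /setU1P[->|aZ] /setU1P[->|bZ]; rewrite ?ltnn //.
- by move=> /(ltn_trans (ltm (subset_trans sZ S21) bZ)); rewrite ltnn.
- by move=> _; have := subsetP sZ _ aZ; rewrite !inE => /and3P[].
- exact: iZ.
Qed.

Lemma quasiU Z x y : Z \subset S2 -> quasi Z x y -> quasi (m |: Z) x y.
Proof.
move=> sZ [xZ yZ xy wxy q]; split=> //; rewrite ?inE ?xZ ?yZ ?orbT //.
move=> a b /setU1P[->|aZ] /setU1P[->|bZ]; rewrite ?ltnn //.
- by move=> /(ltn_trans (ltm (subset_trans sZ S21) bZ)); rewrite ltnn.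
- by move=> _; have := subsetP sZ _ aZ; rewrite !inE => /and3P[].
- exact: q.
Qed.

Lemma aboveU Z y : Z \subset S1 -> y \in Z -> above (m |: Z) y = (above Z y).+1.
Proof.
move=> sZ yZ; rewrite /above.
have -> : [set z in m |: Z | y < z] = m |: [set z in Z | y < z].
  apply/setP=> z; rewrite !inE; case: eqP => [->|//] /=.
  by rewrite (ltm sZ).
by rewrite cardsU1 inE (negbTE (notinm sZ)).
Qed.

Lemma arrowU o Z x y X Y : Z \subset S1 -> x \in Z -> y \in Z ->
  arrow o Z x y X Y -> arrow (~~ o) (m |: Z) x y (m |: Y) (m |: X).
Proof.
move=> sZ xZ yZ; have hx : x != m.
  by apply: contraNneq (notinm sZ) => <-.
have hy : y != m by apply: contraNneq (notinm sZ) => <-.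
by rewrite /arrow !setU1D1 //; case: o => /= -[-> ->].
Qed.

(* The complement makes up for the parity change of [above] in [aboveU]. *)
Definition contract (R : {set T}) := [set X | m |: X \notin R].

(** Complementation reverses the ideal condition, and the new letter [m] above [y] reverses the
    relation, so the two effects cancel. The condition on triples is invariant under complement. *)
Lemma coherent_contract R : coherent S R -> coherent S2 (contract R).
Proof.
move=> [L P]; split.
  move=> Z x y X Y sZ q ar; rewrite !inE; apply: contra.
  have sZ1 := subset_trans sZ S21; have [xZ yZ _ _ _] := q.
  apply: (L (m |: Z) x y); [exact: subU | exact: quasiU |].
  by rewrite aboveU //=; apply: arrowU.
move=> Z a b c sZ iZ aZ bZ cZ ab bc.
have sZ1 := subset_trans sZ S21.
have nm z : z \in Z -> z != m.
  by move=> zZ; apply: contraNneq (notinm sZ1) => <-.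
rewrite !inE -!setU1D1 ?nm // => /(congr1 negb); rewrite !negbK => e.
congr (~~ _); apply: (P _ a b c) => //; rewrite ?inE ?aZ ?bZ ?cZ ?orbT //.
  exact: subU.
exact: inversionsU.
Qed.

Lemma coherent_delete R : coherent S R -> coherent S1 R.
Proof.
have s1 Z : Z \subset S1 -> Z \subset S by move/subset_trans; apply; exact: subsetDl.
move=> [L P]; split.
  by move=> Z x y X Y /s1 sZ; apply: L.
by move=> Z a b c /s1 sZ; apply: P.
Qed.

(** The third layer. Coherence does not make the members of [R] inversion sets, hence the explicit
    condition on [S2]. *)
Definition top (R : {set T}) X := (X \subset S2) && (m |: X \in R).

Lemma notin2 Z t : Z \subset S1 -> t \in Z -> t \notin S2 -> wi t < wi m.
Proof.
move=> sZ tZ; rewrite inE (ltm sZ) // (subsetP (subsetDl S [set m])) ?(subsetP sZ) //.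
rewrite /= -leqNgt leq_eqVlt => /orP[/eqP/winv_inj e|//].
by have := ltm sZ tZ; rewrite e ltnn.
Qed.

Lemma in2 z : z \in S2 -> wi m < wi z.
Proof. by rewrite inE => /and3P[]. Qed.

Lemma sub2D1 Z t : Z :\ t \subset S2 -> (t \in S2) -> Z \subset S2.
Proof.
move=> sZ tS; apply/subsetP=> z zZ; have [->//|zt] := eqVneq z t.
by apply: (subsetP sZ); rewrite !inE zt.
Qed.

(** If [Z] lies in [S2], coherence applied to [m |: Z] carries membership from [X] to [Y]. Otherwise
    the letter deleted from [Z] to form [X] is the only one outside [S2], and each possible
    direction of the edge is contradictory. *)
Lemma top_edge R X Y : coherent S R -> edge S1 R X Y -> top R X -> top R Y.
Proof.
move=> [L P] e /andP[sX XR].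
case: e => [Z x y sZ q ar|Z x y sZ iZ xZ yZ xy ar].
- have [xZ yZ xy wxy qZ] := q.
  have [sZ2|nsZ2] := boolP (Z \subset S2).
    have sY : Y \subset S2.
      apply: subset_trans sZ2.
      by move: ar; rewrite /arrow; case: ifP => _ [_ ->]; exact: subsetDl.
    rewrite /top sY; apply: L XR; first exact: (subU sZ).
      exact: quasiU sZ2 q.
    by rewrite aboveU //=; apply: arrowU.
  case: (boolP (odd _)) ar => od [eX eY].
    have xn : x \notin S2.
      by apply: contra nsZ2; apply: sub2D1; rewrite -eX.
    have wx := notin2 sZ xZ xn.
    (* A letter [z] above [y] would lie in [S2] and be inverted with [x], giving
       [wi m < wi z < wi x < wi m]. *)
    suff z0 : above Z y = 0 by rewrite z0 in od.
    apply/eqP; rewrite cards_eq0; apply/eqP/setP=> z; rewrite !inE.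
    apply/negP=> /andP[zZ yz].
    have zx : z != x by apply: contraTneq yz => ->; rewrite -leqNgt ltnW.
    have := in2 (subsetP sX z _); rewrite eX !inE zx zZ => /(_ isT) wz.
    suff h : wi z < wi x by have := ltn_trans (ltn_trans wx wz) h; rewrite ltnn.
    apply: qZ => //; first exact: ltn_trans yz.
    by apply: contraTneq yz => -[->]; rewrite ltnn.
  have yn : y \notin S2.
    by apply: contra nsZ2; apply: sub2D1; rewrite -eX.
  have wy := notin2 sZ yZ yn.
  have := in2 (subsetP sX x _); rewrite eX !inE xZ andbT.
  have -> : x != y by apply: contraTneq xy => ->; rewrite ltnn.
  by move=> /(_ isT) wx; have := ltn_trans (ltn_trans wx wxy) wy; rewrite ltnn.
have [sZ2|nsZ2] := boolP (Z \subset S2).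
  have sY : Y \subset S2.
    apply: subset_trans sZ2.
    by move: ar; rewrite /arrow; case: ifP => _ [_ ->]; exact: subsetDl.
  rewrite /top sY.
  have nm z : z \in Z -> z != m.
    by move=> zZ; apply: contraNneq (notinm sZ) => <-.
  have := P (m |: Z) x y m (subU sZ) (inversionsU sZ2 iZ).
  rewrite !inE xZ yZ eqxx !orbT xy (ltm sZ yZ) => /(_ isT isT isT isT isT).
  rewrite setU1K ?notinm // !setU1D1 ?nm //.
  case: (boolP (Z \in R)) ar => ZR [eX eY]; rewrite eX in XR; rewrite eY.
    by rewrite XR => ->.
  by rewrite XR /=; case: (_ \in R) => // /(_ erefl).
have tm t : t \in Z -> t \notin S2 -> forall z, z \in Z -> z \in S2 -> z < t.
  move=> tZ tn z zZ zn; rewrite ltnNge leq_eqVlt; apply/negP=> /orP[/eqP/val_inj e|tz].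
    by rewrite e zn in tn.
  by have := ltn_trans (ltn_trans (iZ _ _ tZ zZ tz) (notin2 sZ tZ tn)) (in2 zn); rewrite ltnn.
case: (boolP (Z \in R)) ar => ZR [eX eY].
  have xn : x \notin S2.
    by apply: contra nsZ2; apply: sub2D1; rewrite -eX.
  have := tm x xZ xn y yZ; rewrite (subsetP sX) => [/(_ isT) yx|].
    by have := ltn_trans xy yx; rewrite ltnn.
  by rewrite eX !inE yZ andbT; apply: contraTneq xy => ->; rewrite ltnn.
have yn : y \notin S2.
  by apply: contra nsZ2; apply: sub2D1; rewrite -eX.
(* Here [m |: Z] is a quasi-inversion with non-inverted pair [(y, m)]. No letter exceeds [m], so [Z]
   is below [m |: X], and coherence forces [Z] into [R]. *)
case/negP: ZR; apply: (L (m |: Z) y m Z (m |: X) (subU sZ) _ _ XR); last first.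
  have -> : odd (above (m |: Z) m) = false.
    suff -> : above (m |: Z) m = 0 by [].
    apply/eqP; rewrite cards_eq0; apply/eqP/setP=> z; rewrite !inE.
    case: eqP => [->|_] /=; rewrite ?ltnn //.
    by apply/negP=> /andP[/(ltm sZ) zm /(ltn_trans zm)]; rewrite ltnn.
  split; last first.
    rewrite eX -setU1D1 //.
    by apply: contraNneq (notinm sZ) => <-.
  by rewrite setU1K ?notinm.
split; rewrite ?inE ?yZ ?eqxx ?orbT ?(ltm sZ) ?(notin2 sZ) //.
move=> a b /setU1P[->|aZ] /setU1P[->|bZ]; rewrite ?ltnn //.
- by move=> /(ltn_trans (ltm sZ bZ)); rewrite ltnn.
- move=> _ ay; apply: in2; apply: (subsetP sX); rewrite eX !inE aZ andbT.
  by apply: contraNneq ay => ->.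
- by move=> ab _; apply: iZ.
Qed.

(** If the non-inverted pair ends in [m], no letter is above it, so the relation goes from the
    lowest layer to the middle one. Otherwise deleting [m] changes the parity and reverses the
    edge. *)
Lemma quasi_m Z x y X Y : Z \subset S -> m \in Z -> quasi Z x y ->
  arrow (odd (above Z y)) Z x y X Y ->
  if y == m then [/\ m \notin X, m \in Y & ~~ (X \subset S2)]
  else [/\ m \in X, m \in Y & forall R, edge S2 (contract R) (Y :\ m) (X :\ m)].
Proof.
move=> sZ mZ [xZ yZ xy wxy q].
have xm : x != m.
  by apply: contraTneq xy => ->; rewrite -leqNgt mmax // (subsetP sZ).
case: ifPn => [/eqP ym|ym].
  subst y; have -> : above Z m = 0.
    apply/eqP; rewrite cards_eq0; apply/eqP/setP=> z; rewrite !inE.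
    by apply/negP=> /andP[/(subsetP sZ)/mmax]; rewrite leqNgt => /negP.
  case=> -> ->; split; rewrite ?inE ?eqxx ?mZ ?(eq_sym m) ?xm //.
  apply/negP=> /subsetP/(_ x); rewrite !inE xm xZ => /(_ isT)/and3P[_ _].
  by move/(ltn_trans wxy); rewrite ltnn.
have sZ2 : Z :\ m \subset S2.
  apply/subsetP=> z; rewrite !inE => /andP[zm zZ]; rewrite (subsetP sZ) //=.
  have zlm : z < m.
    by have := mmax (subsetP sZ _ zZ); rewrite leq_eqVlt (inj_eq val_inj) (negbTE zm).
  by rewrite zlm; apply: q => //; apply: contraNneq ym => -[_ ->].
have ab : above Z y = (above (Z :\ m) y).+1.
  rewrite -{1}(setD1K mZ) aboveU //; last by rewrite !inE ym.
  exact: subset_trans sZ2 S21.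
move=> ar; have [mX mY] : m \in X /\ m \in Y.
  by move: ar; case: odd => -[-> ->]; rewrite !inE mZ !(eq_sym m) xm ym.
split=> // R; apply: (@EdgeQuasi _ _ _ _ (Z :\ m) x y sZ2).
  split; rewrite ?inE ?xm ?ym //.
  by move=> a b /setD1P[_ aZ] /setD1P[_ bZ]; apply: q.
by move: ar; rewrite ab /=; case: odd => -[-> ->]; split; rewrite setD1C.
Qed.

(** If [y] is [m], then [Z :\ m] is in the top layer exactly when [Z] is in [R], and this membership
    also directs the arrow. Otherwise the complement in [contract] reverses the edge. *)
Lemma inversions_m (R : {set T}) Z x y X Y : Z \subset S -> m \in Z -> inversions Z ->
  x \in Z -> y \in Z -> x < y -> arrow (Z \in R) Z x y X Y ->
  [\/ [/\ m \notin X, m \in Y & ~~ top R X],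
      [/\ m \in X, m \notin Y & top R Y] |
      [/\ m \in X, m \in Y & edge S2 (contract R) (Y :\ m) (X :\ m)]].
Proof.
move=> sZ mZ iZ xZ yZ xy.
have xm : x != m.
  by apply: contraTneq xy => ->; rewrite -leqNgt mmax // (subsetP sZ).
have sZ2 : Z :\ m \subset S2.
  apply/subsetP=> z; rewrite !inE => /andP[zm zZ]; rewrite (subsetP sZ) //=.
  have zlm : z < m.
    by have := mmax (subsetP sZ _ zZ); rewrite leq_eqVlt (inj_eq val_inj) (negbTE zm).
  by rewrite zlm; apply: iZ.
have [ym|ym] := eqVneq y m.
  subst y; rewrite /top; case: (boolP (Z \in R)) => ZR [-> ->].
    by apply: Or32; split; rewrite ?inE ?eqxx ?mZ ?(eq_sym m) ?xm // setD1K // sZ2.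
  by apply: Or31; split; rewrite ?inE ?eqxx ?mZ ?(eq_sym m) ?xm // setD1K // sZ2.
move=> ar; have [mX mY] : m \in X /\ m \in Y.
  by move: ar; case: (Z \in R) => -[-> ->]; rewrite !inE mZ !(eq_sym m) xm ym.
apply: Or33; split=> //; apply: (@EdgeInv _ _ _ _ (Z :\ m) x y sZ2) => //.
- by move=> a b /setD1P[_ aZ] /setD1P[_ bZ]; apply: iZ.
- by rewrite !inE xm.
- by rewrite !inE ym.
by move: ar; rewrite inE setD1K //; case: (Z \in R) => -[-> ->]; split; rewrite setD1C.
Qed.

End Step.

(** * Gluing the rank functions of the layers *)

Lemma bounded (f : T -> nat) : exists N, forall X, f X < N.
Proof.
by exists (\max_X f X).+1 => X; rewrite ltnS (leq_bigmax X).
Qed.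

(** A strictly increasing rank certifies acyclicity and yields linear extensions by sorting. The
    induction is on the size of [S]. *)
Theorem coherent_rank S R :
  coherent S R -> exists f : T -> nat, forall X Y, edge S R X Y -> f X < f Y.
Proof.
have [N] := ubnP #|S|; elim: N S R => // N IH S R; rewrite ltnS => leS clR.
have [S0|[m0 m0S]] := set_0Vmem S.
  exists (fun=> 0) => X Y [Z x y + [xZ _ _ _ _]|Z x y + _ xZ] => /subsetP/(_ x xZ);
  by rewrite S0 inE.
pose m := [arg max_(i > m0 in S) val i].
have [mS mmax] : m \in S /\ forall s, s \in S -> s <= m.
  by rewrite /m; case: arg_maxnP => // i iS h; split.
clearbody m; have lt1 : #|S :\ m| < N by rewrite (leq_trans _ leS) // (cardsD1 m S) mS.
have lt2 : #|[set s in S | (s < m) && (wi m < wi s)]| < N.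
  exact: leq_ltn_trans (subset_leq_card (S21 _ _)) lt1.
have [f fP] := IH _ _ lt1 (coherent_delete m clR).
have [g gP] := IH _ _ lt2 (coherent_contract mS mmax clR).
have [A fA] := bounded f; have [B gB] := bounded g.
(* As [f < A] and [g < B], the layers take values below [A], in [A + 1 .. A + B], and above [A + B].
   Subtracting [g] reverses the contraction. *)
pose F X := if m \in X then A + (B - g (X :\ m))
            else if top S m R X then A + B + f X + 1 else f X.
exists F => X Y e.
have lvl X' : m \in X' -> A < F X' <= A + B.
  by move=> mX; rewrite /F mX; have := gB (X' :\ m); lia.
have con (Z W : T) : m \in Z -> m \in W ->
    edge [set s in S | (s < m) && (wi m < wi s)] (contract m R) (W :\ m) (Z :\ m) ->
    F Z < F W.
  by move=> mZ mW /gP; rewrite /F mZ mW; have := gB (Z :\ m); lia.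
have lo (Z : T) : m \notin Z -> ~~ top S m R Z -> F Z < A.
  by move=> /negbTE mZ /negbTE tZ; rewrite /F mZ tZ.
have hi (Z : T) : m \notin Z -> top S m R Z -> A + B < F Z.
  by move=> /negbTE mZ tZ; rewrite /F mZ tZ; lia.
have dele Z : m \notin Z -> Z \subset S -> Z \subset S :\ m.
  by move=> mZ sZ; rewrite subsetD1 sZ.
have del1 : m \notin X -> m \notin Y -> edge (S :\ m) R X Y -> F X < F Y.
  move=> /negbTE mX /negbTE mY e1; rewrite /F mX mY.
  have := top_edge mS mmax clR e1; have := fP _ _ e1; have := fA X.
  by case: ifP => _; case: ifP => _ //; try lia; move=> _ _ /(_ isT).
have notm Z x y o : m \notin Z -> arrow o Z x y X Y -> m \notin X /\ m \notin Y.
  by move=> /negbTE mZ; rewrite /arrow; case: o => -[-> ->]; rewrite !inE mZ !andbF.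
case: e => [Z x y sZ q ar|Z x y sZ iZ xZ yZ xy ar].
  have [mZ|mZ] := boolP (m \in Z).
    have := quasi_m mmax sZ mZ q ar; case: ifP => _ [mX mY] h; last exact: con.
    have /andP[h1 _] := lvl Y mY; apply: ltn_trans h1.
    by apply: lo mX _; rewrite /top (negbTE h).
  have [mX mY] := notm _ _ _ _ mZ ar; apply: del1 => //.
  by apply: EdgeQuasi q ar; apply: dele.
have [mZ|mZ] := boolP (m \in Z).
  case: (inversions_m mmax sZ mZ iZ xZ yZ xy ar) => -[mX mY h]; last exact: con.
    by have /andP[h1 _] := lvl Y mY; apply: ltn_trans h1; apply: lo.
  by have /andP[_ h1] := lvl X mX; apply: leq_ltn_trans h1 _; apply: hi.
have [mX mY] := notm _ _ _ _ mZ ar; apply: del1 => //.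
by apply: EdgeInv xy ar => //; apply: dele.
Qed.

End Acyclic.

(** * Prefixes and suffixes cut out by a predicate *)

Section Lists.
Variable T : eqType.
Implicit Types (s : seq T) (p : pred T).

(** Both sides say that the truth value of [p] changes at most once along [s]. *)
Lemma prefix_or_suffix_filterP x0 s p : uniq s ->
  reflect (forall i j l, i < j -> j < l -> l < size s ->
             p (nth x0 s i) = p (nth x0 s l) -> p (nth x0 s j) = p (nth x0 s i))
    (prefix (filter p s) s || suffix (filter p s) s).
Proof.
move=> us; apply: (iffP orP).
  have all_p t : all p t -> forall i, i < size t -> p (nth x0 t i).
    by move=> /all_nthP h i; apply: h.
  have none_p t : filter p t = [::] -> forall i, i < size t -> p (nth x0 t i) = false.
    move=> h i it; apply/negbTE/negP=> pi.
    have : nth x0 t i \in filter p t by rewrite mem_filter pi mem_nth.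
    by rewrite h.
  have filt t : all p (filter p t) by exact: filter_all.
  case=> [/prefixP[u e]|/suffixP[u e]] i j l ij jl.
    set t := filter p s in e.
    have at' : all p t by exact: filt.
    have u0 : filter p u = [::].
      have := congr1 (filter p) e; rewrite filter_cat (all_filterP at') -/t.
      move/(congr1 size); rewrite size_cat => h; apply/eqP; rewrite -size_eq0; lia.
    have val q : q < size s -> p (nth x0 s q) = (q < size t).
      rewrite e size_cat nth_cat => qs; case: ltnP => qt; first exact: all_p.
      by apply: none_p => //; lia.
    by move=> ls; rewrite !val; lia.
  set t := filter p s in e.
  have at' : all p t by exact: filt.
  have u0 : filter p u = [::].
    have := congr1 (filter p) e; rewrite filter_cat (all_filterP at') -/t.
    move/(congr1 size); rewrite size_cat => h; apply/eqP; rewrite -size_eq0; lia.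
  have val q : q < size s -> p (nth x0 s q) = (size u <= q).
    rewrite e size_cat nth_cat => qs; case: ltnP => qt; first exact: none_p.
    by apply: all_p => //; lia.
  by move=> ls; rewrite !val; lia.
case: s us => [|x s] us pat; first by left.
have cut q : q <= size (x :: s) -> (forall i, i < q -> p (nth x0 (x :: s) i) = p x) ->
    (forall i, q <= i < size (x :: s) -> p (nth x0 (x :: s) i) = ~~ p x) ->
    filter p (x :: s) = if p x then take q (x :: s) else drop q (x :: s).
  move: (x :: s) (p x) => s' b qs h1 h2.
  rewrite -{1}(cat_take_drop q s') filter_cat.
  have e1 : filter p (take q s') = if b then take q s' else [::].
    have : {in take q s', p =1 fun=> b}.
      move=> z /(nthP x0)[i]; rewrite size_take_min => iq <-.
      by rewrite nth_take ?h1 //; lia.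
    by move/eq_in_filter=> ->; case: b {h1 h2}; rewrite ?filter_predT ?filter_pred0.
  have e2 : filter p (drop q s') = if b then [::] else drop q s'.
    have : {in drop q s', p =1 fun=> ~~ b}.
      move=> z /(nthP x0)[i]; rewrite size_drop => iq <-.
      by rewrite nth_drop ?h2 //; lia.
    by move/eq_in_filter=> ->; case: b {h1 h2 e1}; rewrite ?filter_predT ?filter_pred0.
  by rewrite e1 e2; case: b {h1 h2 e1 e2}; rewrite ?cats0.
(* The first position where [p] differs from its value at the head; the hypothesis on [0 < q < i]
   excludes a second change. *)
pose q := find (fun z => p z != p x) (x :: s).
have hq : filter p (x :: s) = if p x then take q (x :: s) else drop q (x :: s).
  apply: cut; first exact: find_size.
    by move=> i /(before_find x0)/negbFE/eqP.
  move=> i /andP[qi si].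
  have hs : has (fun z => p z != p x) (x :: s) by rewrite has_find; exact: leq_ltn_trans si.
  have nq : p (nth x0 (x :: s) q) != p x := nth_find x0 hs.
  have q0 : 0 < q by rewrite /q /= eqxx.
  move: qi; rewrite leq_eqVlt => /orP[/eqP <-|qi]; first by move: nq; do 2 case: (p _).
  have : p x = p (nth x0 (x :: s) i) -> p (nth x0 (x :: s) q) = p x := pat 0 q i q0 qi si.
  by move: nq; do 3 case: (p _) => //; move=> _ /(_ erefl).
rewrite hq; case: (p x); [left; exact: prefix_take|right; exact: suffix_drop].
Qed.

Lemma sorted_index s : uniq s -> sorted (fun x y => index x s < index y s) s.
Proof.
case: s => [//|x0 s] us; apply/(sortedP x0) => i hi.
by rewrite !index_uniq //; apply: ltnW.
Qed.

Lemma pairwise_split (r : rel T) s1 x s2 y s3 :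
  pairwise r (s1 ++ x :: s2 ++ y :: s3) -> r x y.
Proof.
rewrite pairwise_cat => /and3P[_ _] /= /andP[+ _].
by rewrite all_cat => /andP[_] /= /andP[].
Qed.

(** * Linear extensions of a relation and adjacent swaps *)

Section LinearExtensions.
Variable le : rel T.
Local Notation ext s := (pairwise (fun x y => ~~ le y x) s).

Inductive swap s t : Prop :=
  Swap s1 s2 x y of ~~ le x y & ~~ le y x & s = s1 ++ x :: y :: s2
    & t = s1 ++ y :: x :: s2.

Lemma swaps_cat u s t :
  clos_refl_trans _ swap s t -> clos_refl_trans _ swap (u ++ s) (u ++ t).
Proof.
elim=> [{}s {}t [s1 s2 x y xy yx -> ->]|{}s|s1 s2 s3 _ h1 _ h2].
- by apply: rt_step; exists (u ++ s1) s2 x y; rewrite ?catA.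
- exact: rt_refl.
- exact: rt_trans h2.
Qed.

(** Induction on the target list: its head [y] is moved to the front of [s]. Every element passed on
    the way precedes [y] in one list and follows it in the other, so it is incomparable with [y]. *)
Lemma ext_connected s t :
  perm_eq s t -> ext s -> ext t -> clos_refl_trans _ swap s t.
Proof.
elim: t s => [|y t IH] s.
  by move=> /perm_size/eqP; rewrite size_eq0 => /eqP -> _ _; apply: rt_refl.
move=> st es et; have ys : y \in s by rewrite (perm_mem st) mem_head.
case/splitPr: ys st es => s1 s2 st es.
have st' : perm_eq (s1 ++ s2) t.
  rewrite -(perm_cons y); apply: perm_trans st.
  by rewrite perm_sym -(cat1s y s2) perm_catCA.
have es' : ext (s1 ++ s2).
  move: es; rewrite !pairwise_cat /= allrel_consr => /and3P[/andP[_ ->] -> /andP[_ ->]] //.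
apply: rt_trans (_ : clos_refl_trans _ swap (y :: s1 ++ s2) _); last first.
  by apply: (@swaps_cat [:: y]); apply: IH => //; case/andP: et.
have h1 : all (fun x => ~~ le x y && ~~ le y x) s1.
  apply/allP=> x xs; apply/andP; split.
    by case/andP: et => /allP h _; apply: h; rewrite -(perm_mem st') mem_cat xs.
  by case/splitPr: xs es => u v; rewrite -catA; apply: pairwise_split.
(* [y] first passes the last element of [s1], its neighbour. *)
elim/last_ind: s1 s2 h1 {es es' st st'} => [|s1 x IHs] s2; first by move=> _; apply: rt_refl.
rewrite all_rcons => /andP[/andP[xy yx] h].
apply: rt_trans (_ : clos_refl_trans _ swap (s1 ++ y :: x :: s2) _).
  by apply: rt_step; exists s1 s2 x y; rewrite ?cat_rcons.
by rewrite cat_rcons; apply: IHs.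
Qed.

Lemma swap_ext s t : swap s t -> ext s -> ext t.
Proof.
case=> s1 s2 x y xy yx -> ->.
rewrite !pairwise_cat /= !allrel_consr xy yx /=.
by case/and3P=> /and3P[-> -> ->] -> /and3P[-> -> ->].
Qed.

Lemma swap_perm s t : swap s t -> perm_eq s t.
Proof.
by case=> s1 s2 x y _ _ -> ->; rewrite perm_cat2l -(cat1s x) -(cat1s y) perm_catCA.
Qed.

End LinearExtensions.
End Lists.

(** * Packets as lists of one-letter deletions *)

Section Packets.
Variables (n : nat) (w : {perm 'I_n}).
Local Notation T := {set 'I_n}.
Local Notation wi := (winv w).
Implicit Types (X Y Z W : T) (x y z a b c : 'I_n) (R : {set T}).

Lemma mem_elems X x : (x \in elems X) = (x \in X).
Proof. by rewrite mem_sort mem_enum. Qed.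

Lemma elems_uniq X : uniq (elems X).
Proof. by rewrite sort_uniq enum_uniq. Qed.

Lemma size_elems X : size (elems X) = #|X|.
Proof. by rewrite size_sort cardE. Qed.

Lemma elems_sorted X : sorted (fun a b : 'I_n => a < b) (elems X).
Proof.
rewrite -[sorted _ _]/(sorted (relpre val ltn) _) -sorted_map.
rewrite ltn_sorted_uniq_leq map_inj_uniq; last exact: val_inj.
rewrite elems_uniq sorted_map; apply: sort_sorted => a b; exact: leq_total.
Qed.

Lemma index_elems X a b : a \in X -> b \in X ->
  (index a (elems X) < index b (elems X)) = (a < b).
Proof.
move=> aX bX; have tr : transitive (fun a b : 'I_n => a < b).
  by move=> ? ? ?; apply: ltn_trans.
have H x y : x \in X -> y \in X -> index x (elems X) < index y (elems X) -> x < y.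
  by move=> xX yX; apply: (sorted_ltn_index tr (elems_sorted X)); rewrite ?mem_elems.
apply/idP/idP; first exact: H.
move=> ab; rewrite ltnNge leq_eqVlt; apply/negP=> /orP[/eqP e|/H h].
  have e' : b = a by apply: (index_inj a _ _ e); rewrite mem_elems.
  by rewrite e' ltnn in ab.
by have := ltn_trans ab (h bX aX); rewrite ltnn.
Qed.

Lemma InvP m X : reflect (#|X| = m /\ inversions w X) (Inv w m X).
Proof.
apply: (iffP andP) => -[/eqP cX iX]; split; rewrite ?cX //.
  move=> a b aX bX; rewrite -(index_elems aX bX).
  have tr : transitive (fun a b : 'I_n => wi b < wi a).
    by move=> ? ? ? h1 h2; apply: ltn_trans h2 h1.
  by apply: (sorted_ltn_index tr iX); rewrite ?mem_elems.
apply: (@sub_in_sorted _ [in X] (fun a b : 'I_n => a < b)) (elems_sorted X).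
  by move=> a b aX bX; apply: iX.
by apply/allP=> a; rewrite mem_elems.
Qed.

Lemma Inv_inversions m X : Inv w m X -> inversions w X.
Proof. by case/InvP. Qed.

Lemma inversionsD1 X x : inversions w X -> inversions w (X :\ x).
Proof. by move=> iX a b /setD1P[_ aX] /setD1P[_ bX]; apply: iX. Qed.

Lemma Inv_D1 m X x : x \in X -> Inv w m.+1 X -> Inv w m (X :\ x).
Proof.
move=> xX /InvP[cX iX]; apply/InvP; split; last exact: inversionsD1.
by have := cardsD1 x X; rewrite xX cX => -[].
Qed.

(** [del] counts positions from 1 and [nth] from 0, hence the shift. *)
Lemma delE x0 X i : i < #|X| -> del X i.+1 = X :\ nth x0 (elems X) i.
Proof.
rewrite -size_elems => iX; apply/setP=> z; rewrite !inE.
case zX: (z \in X); rewrite ?andbF ?andbT //=.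
congr (~~ _); apply/eqP/eqP => [<-|->]; last by rewrite index_uniq ?elems_uniq.
by rewrite nth_index ?mem_elems.
Qed.

Lemma antilexE X : antilex X = [seq X :\ x | x <- elems X].
Proof.
have [->|[x0 x0X]] := set_0Vmem X.
  rewrite /antilex /elems cards0 /=.
  by have /eqP := cards0 'I_n; rewrite cardE size_eq0 => /eqP ->.
apply: (@eq_from_nth _ set0); first by rewrite !size_map size_iota size_elems.
move=> i; rewrite size_map size_iota => iX.
rewrite (nth_map 0) ?size_iota // (nth_map x0) ?size_elems // nth_iota // add1n.
exact: delE.
Qed.

Lemma lexE X : lex X = rev (antilex X).
Proof. exact: map_rev. Qed.

Lemma mem_lex X Y : (Y \in lex X) = (Y \in antilex X).
Proof. by rewrite lexE mem_rev. Qed.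

Lemma antilexP X Y : reflect (exists2 x, x \in X & Y = X :\ x) (Y \in antilex X).
Proof.
rewrite antilexE; apply: (iffP mapP) => -[x xX ->]; exists x => //.
  by rewrite -mem_elems.
by rewrite mem_elems.
Qed.

Lemma antilex_D1 X x : x \in X -> X :\ x \in antilex X.
Proof. by move=> xX; apply/antilexP; exists x. Qed.

Lemma antilex_uniq X : uniq (antilex X).
Proof.
rewrite antilexE map_inj_in_uniq ?elems_uniq // => a b.
by rewrite mem_elems => aX _; apply: setD1_inj.
Qed.

Lemma size_antilex X : size (antilex X) = #|X|.
Proof. by rewrite size_map size_iota. Qed.

(** A repetition-free list with at least two entries has distinct first and last entries, so it is
    not its own reversal. *)
Lemma lex_antilex X : 1 < #|X| -> lex X != antilex X.
Proof.
rewrite lexE; have := antilex_uniq X; rewrite -size_antilex.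
case: (antilex X) => [|Y s] //= /andP[Ys _] s0; apply/eqP.
rewrite rev_cons; case/lastP: s Ys s0 => [//|s Z] + _.
by rewrite rev_rcons mem_rcons inE negb_or => /andP[/eqP YZ _] [/esym].
Qed.

(** Two distinct members of a packet have the underlying set as their union. *)
Lemma packet_meet X Y U V : U != V -> U \in antilex X -> V \in antilex X ->
  U \in antilex Y -> V \in antilex Y -> X = Y.
Proof.
suff H X1 : U != V -> U \in antilex X1 -> V \in antilex X1 -> X1 = U :|: V.
  by move=> UV *; rewrite (H X) // (H Y).
move=> UV /antilexP[a aX eU] /antilexP[b bX eV].
have ab : a != b by apply: contraNneq UV => ab; rewrite eU eV ab.
apply/setP=> z; rewrite eU eV !inE.
have [->|_] := eqVneq z a; first by rewrite ab aX.
by case: (z \in X1) => /=; rewrite ?andbF ?orbT.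
Qed.

(** * Quasi-inversions and their relations *)

Lemma quasi_invP Z : reflect (exists x y, quasi w Z x y) (quasi_inv w Z).
Proof.
apply: (iffP cards1P) => [[[x y] e]|[x [y [xZ yZ xy wxy q]]]].
  have m a b : [&& a \in Z, b \in Z, a < b & ~~ inv2 w a b] = ((a, b) == (x, y)).
    by move/setP: e => /(_ (a, b)); rewrite !inE.
  have := m x y; rewrite eqxx => /and4P[xZ yZ xy]; rewrite /inv2 -leqNgt => wxy.
  exists x, y; split=> // [|a b aZ bZ ab ne].
    rewrite ltn_neqAle wxy andbT; apply: contraTneq xy => /winv_inj ->.
    by rewrite ltnn.
  by have := m a b; rewrite aZ bZ ab (negbTE ne) /= => /negbFE.
exists (x, y); apply/setP=> -[a b]; rewrite !inE /=.
apply/idP/eqP => [/and4P[aZ bZ ab nab]|[-> ->]].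
  by apply/eqP; apply: contraNT nab => ne; apply: q.
by rewrite xZ yZ xy /inv2 -leqNgt ltnW.
Qed.

Lemma quasi_neq Z x y : quasi w Z x y -> x != y.
Proof. by case=> _ _ + _ _; apply: contraTneq => ->; rewrite ltnn. Qed.

Lemma quasi_D1l Z x y : quasi w Z x y -> inversions w (Z :\ x).
Proof.
case=> _ _ xy _ q a b /setD1P[ax aZ] /setD1P[bx bZ] ab; apply: q => //.
by apply: contraNneq ax => -[->].
Qed.

Lemma quasi_D1r Z x y : quasi w Z x y -> inversions w (Z :\ y).
Proof.
case=> _ _ xy _ q a b /setD1P[ax aZ] /setD1P[bx bZ] ab; apply: q => //.
by apply: contraNneq bx => -[_ ->].
Qed.

Lemma quasi_D1_inv Z x y z :
  quasi w Z x y -> inversions w (Z :\ z) -> (z == x) || (z == y).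
Proof.
move=> [xZ yZ xy wxy _] iZ; apply/negP=> /negP; rewrite negb_or => /andP[zx zy].
have := iZ x y; rewrite !inE !(eq_sym _ z) zx zy xZ yZ => /(_ isT isT xy).
by move/(ltn_trans wxy); rewrite ltnn.
Qed.

(* A letter [c] between [x] and [y] would be inverted with both, which forces
   the pair [(x, y)] to be inverted too. *)
Lemma quasi_adjacent Z x y c : quasi w Z x y -> c \in Z -> x < c -> c < y -> False.
Proof.
move=> [xZ yZ xy wxy q] cZ xc cy.
have h1 : wi c < wi x.
  by apply: q => //; apply: contraTneq cy => -[->]; rewrite ltnn.
have h2 : wi y < wi c.
  by apply: q => //; apply: contraTneq xc => -[->]; rewrite ltnn.
by have := ltn_trans (ltn_trans h2 h1) wxy; rewrite ltnn.
Qed.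

Lemma quasi_index Z x y : quasi w Z x y ->
  index y (elems Z) = (index x (elems Z)).+1.
Proof.
move=> q; have [xZ yZ xy _ _] := q; have := index_elems xZ yZ; rewrite xy => ixy.
apply/eqP; rewrite eqn_leq ixy andbT leqNgt; apply/negP=> h.
have yl : index y (elems Z) < size (elems Z) by rewrite index_mem mem_elems.
pose c := nth x (elems Z) (index x (elems Z)).+1.
have ic : index c (elems Z) = (index x (elems Z)).+1.
  by rewrite index_uniq ?elems_uniq //; apply: ltn_trans yl.
have cZ : c \in Z by rewrite -mem_elems -index_mem ic; apply: ltn_trans yl.
apply: (quasi_adjacent q cZ); first by rewrite -(index_elems xZ cZ) ic.
by rewrite -(index_elems cZ yZ) ic.
Qed.

Lemma above_index Z y : y \in Z -> above Z y + (index y (elems Z)).+1 = #|Z|.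
Proof.
move=> yZ; rewrite /above -(size_elems Z).
have -> : #|[set z in Z | y < z]| = count (fun z : 'I_n => y < z) (elems Z).
  rewrite cardE -size_filter; apply/perm_size/uniq_perm; first exact: enum_uniq.
    by rewrite filter_uniq ?elems_uniq.
  by move=> z; rewrite mem_enum inE mem_filter mem_elems andbC.
have tr : transitive (fun a b : 'I_n => a < b).
  by move=> ? ? ?; apply: ltn_trans.
have := elems_uniq Z; have := elems_sorted Z; rewrite (sorted_pairwise tr).
have : y \in elems Z by rewrite mem_elems.
case/splitPr=> s1 s2; rewrite pairwise_cat /= allrel_consr.
move=> /and3P[/andP[s1y _] _ /andP[ys2 _]]; rewrite cat_uniq /= => /and3P[_ + _].
rewrite negb_or => /andP[ys1 _]; rewrite count_cat index_cat (negbTE ys1) /= eqxx ltnn.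
have -> : count (fun z : 'I_n => y < z) s1 = 0.
  apply/eqP; rewrite -leqn0 leqNgt -has_count; apply/hasP=> -[z zs].
  by move/allP: s1y => /(_ z zs) zy /(ltn_trans zy); rewrite ltnn.
move: ys2; rewrite all_count => /eqP ->; rewrite size_cat /=; lia.
Qed.

(** A deletion is an inversion set only if it removes a letter of the single non-inverted pair. *)
Lemma quasi_packet m Z x y : #|Z| = m.+1 -> quasi w Z x y ->
  [set W in antilex Z | Inv w m W] = [set Z :\ x; Z :\ y].
Proof.
move=> cZ q; have [xZ yZ _ _ _] := q.
have c1 z : z \in Z -> #|Z :\ z| = m.
  by move=> zZ; have := cardsD1 z Z; rewrite cZ zZ => -[].
apply/setP=> W; rewrite !inE; apply/andP/orP.
  case=> /antilexP[z zZ ->] /Inv_inversions /(quasi_D1_inv q).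
  by case/orP=> /eqP ->; [left|right].
case=> /eqP ->; (split; first by rewrite antilex_D1); apply/InvP; split; rewrite ?c1 //.
  exact: quasi_D1l q.
exact: quasi_D1r q.
Qed.

(** The part of the packet inside [Inv_m] is [{Z :\ x, Z :\ y}], so the index in [qrel] must be the
    position of [x], and [m - i] becomes [above Z y]. *)
Lemma qrelP m X Y :
  reflect (exists Z x y, [/\ #|Z| = m.+1, quasi w Z x y
                           & arrow (odd (above Z y)) Z x y X Y])
    (qrel w m X Y).
Proof.
apply: (iffP existsP) => [[Z /existsP[[[|j] jm]]]|[Z [x [y [cZ q ar]]]]].
- by case/and5P.
- case/and5P=> /eqP cZ /quasi_invP[x [y q]] _ /eqP e ar.
  rewrite /= in ar e; have [xZ yZ _ _ _] := q.
  have ab := above_index yZ; have ixy := quasi_index q.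
  rewrite (quasi_packet cZ q) !(delE x) ?cZ ?(ltnW jm) // in e ar.
  have ind z : z \in Z -> Z :\ z \in [set Z :\ x; Z :\ y] ->
      (index z (elems Z) == j) || (index z (elems Z) == j.+1).
    move=> zZ; rewrite e !inE => /orP[]/eqP/(setD1_inj zZ) ->;
    by rewrite index_uniq ?elems_uniq ?size_elems ?cZ ?eqxx ?orbT // ltnW.
  have := ind x xZ; have := ind y yZ; rewrite !inE !eqxx orbT ixy.
  move=> /(_ isT) iy /(_ isT) ix; have ixj : index x (elems Z) = j by lia.
  exists Z, x, y; split=> //.
  have <- : m - j.+1 = above Z y by lia.
  have ex : nth x (elems Z) j = x by rewrite -ixj nth_index ?mem_elems.
  have ey : nth x (elems Z) j.+1 = y by rewrite -ixj -ixy nth_index ?mem_elems.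
  rewrite ex ey in ar.
  by move: ar; case: odd => /andP[/eqP -> /eqP ->].
have [xZ yZ _ _ _] := q.
have ab := above_index yZ; have ixy := quasi_index q.
have im : index y (elems Z) < m.+1 by rewrite -cZ -size_elems index_mem mem_elems.
have d1 : del Z (index y (elems Z)) = Z :\ x.
  rewrite ixy (delE x) ?nth_index ?mem_elems // cZ; apply: ltn_trans im.
  by rewrite ixy.
have d2 : del Z (index y (elems Z)).+1 = Z :\ y.
  by rewrite (delE x) ?nth_index ?mem_elems // cZ.
(* The position of [x] counted from 1 equals the index of [y] counted from 0. *)
exists Z; apply/existsP; exists (Ordinal im); rewrite /= d1 d2 cZ eqxx {1}ixy /=.
apply/and3P; split; first by apply/quasi_invP; exists x, y.
  by rewrite (quasi_packet cZ q).
have -> : m - index y (elems Z) = above Z y by lia.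
by move: ar; case: odd => -[-> ->]; rewrite !eqxx.
Qed.

Lemma qrel_Inv m X Y : qrel w m X Y -> Inv w m X /\ Inv w m Y.
Proof.
case/qrelP=> Z [x [y [cZ q ar]]]; have := quasi_packet cZ q.
move/setP=> h; have := h (Z :\ x); have := h (Z :\ y); rewrite !inE !eqxx orbT.
by move=> /andP[_ hy] /andP[_ hx]; case: odd ar => -[-> ->].
Qed.

Lemma qrel_edge m R X Y : qrel w m X Y -> edge w setT R X Y.
Proof. by case/qrelP=> Z [x [y [_ q ar]]]; apply: EdgeQuasi q ar; apply: subsetT. Qed.

(** * Edges of [G_R] and consistent sets *)

Lemma antilex_nth x0 X i : i < #|X| -> nth set0 (antilex X) i = X :\ nth x0 (elems X) i.
Proof. by move=> iX; rewrite antilexE (nth_map x0) ?size_elems. Qed.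

Lemma nth_elems_lt x0 X i j : i < j -> j < #|X| ->
  [/\ nth x0 (elems X) i \in X, nth x0 (elems X) j \in X
    & nth x0 (elems X) i < nth x0 (elems X) j].
Proof.
move=> ij jX; have iX := ltn_trans ij jX.
have m q : q < #|X| -> nth x0 (elems X) q \in X.
  by move=> qX; rewrite -mem_elems mem_nth ?size_elems.
by rewrite -(index_elems (m _ iX) (m _ jX)) !index_uniq ?elems_uniq ?size_elems ?m.
Qed.

Lemma Gedge_edge k R X Y : Gedge w k R X Y -> edge w setT R X Y.
Proof.
case/orP=> [/qrel_edge //|/existsP[Z /existsP[[[|i] ik]]]]; first by rewrite /= andbF.
case/and3P=> /= /InvP[cZ iZ] _ h.
have [x0 x0Z] : exists x0, x0 \in Z by apply/card_gt0P; rewrite cZ.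
have ik' : i.+1 < #|Z| by rewrite cZ.
have [aZ bZ ab] := nth_elems_lt x0 (ltnSn i) ik'.
rewrite !(delE x0) // ?(ltnW ik') // in h.
apply: EdgeInv iZ aZ bZ ab _; first exact: subsetT.
by case/orP: h => /andP[/andP[+ /eqP ->] /eqP ->]; [move=> -> | move=> /negbTE ->].
Qed.

(* Consecutive members of a packet are joined by an edge; this chains them. *)
Lemma leR_packet k R Z x y X Y : Inv w k.+1 Z -> x \in Z -> y \in Z -> x < y ->
  arrow (Z \in R) Z x y X Y -> leR w k R X Y.
Proof.
move=> iZ xZ yZ; rewrite -(index_elems xZ yZ) => ixy ar.
have [cZ _] := InvP _ _ iZ.
have step i : i.+1 < #|Z| -> forall X Y,
    arrow (Z \in R) Z (nth x (elems Z) i) (nth x (elems Z) i.+1) X Y -> leR w k R X Y.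
  move=> iZ' X' Y' ar'; apply: connect1; apply/orP; right.
  apply/existsP; exists Z; apply/existsP.
  have ik : i.+1 < k.+1 by rewrite -cZ.
  exists (Ordinal ik); rewrite iZ /= !(delE x) // ?(ltnW iZ') //.
  by move: ar'; case: (Z \in R) => -[-> ->]; rewrite !eqxx ?orbT.
have yl : index y (elems Z) < #|Z| by rewrite -size_elems index_mem mem_elems.
have chain d i : i + d.+1 < #|Z| -> forall X Y,
    arrow (Z \in R) Z (nth x (elems Z) i) (nth x (elems Z) (i + d.+1)) X Y ->
    leR w k R X Y.
  elim: d => [|d IH] iZ' X' Y'; first by rewrite addn1; apply: step; rewrite -addn1.
  have iZ2 : i + d.+1 < #|Z| by apply: ltn_trans iZ'; rewrite ltn_add2l.
  have {}IH := IH iZ2; have := step (i + d.+1); rewrite -addnS => /(_ iZ') st.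
  move: IH st; rewrite /arrow; case: (Z \in R) => IH st [-> ->].
    by apply: connect_trans (IH _ _ (conj erefl erefl)) (st _ _ (conj erefl erefl)).
  by apply: connect_trans (st _ _ (conj erefl erefl)) (IH _ _ (conj erefl erefl)).
have := chain (index y (elems Z) - (index x (elems Z)).+1) (index x (elems Z)).
have -> : index x (elems Z) + (index y (elems Z) - (index x (elems Z)).+1).+1
        = index y (elems Z) by lia.
by move=> /(_ yl); rewrite !nth_index ?mem_elems //; apply.
Qed.

(** Reversing the packet exchanges prefixes and suffixes, so the criterion may be read on the
    antilex list. *)
Lemma prefix_or_suffix_packetP Z R :
  reflect (forall a b c, a \in Z -> b \in Z -> c \in Z -> a < b -> b < c ->
             (Z :\ a \in R) = (Z :\ c \in R) -> (Z :\ b \in R) = (Z :\ a \in R))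
    (let s := [seq Y <- lex Z | Y \in R] in prefix s (lex Z) || suffix s (lex Z)).
Proof.
rewrite /= lexE filter_rev prefix_rev suffix_rev orbC.
apply: (iffP (prefix_or_suffix_filterP set0 _ (antilex_uniq Z))) => pat.
  move=> a b c aZ bZ cZ; rewrite -(index_elems aZ bZ) -(index_elems bZ cZ) => ab bc.
  have cl : index c (elems Z) < #|Z| by rewrite -size_elems index_mem mem_elems.
  have := pat _ _ _ ab bc; rewrite size_antilex => /(_ cl).
  have bl := ltn_trans bc cl; have al := ltn_trans ab bl.
  by rewrite !(antilex_nth a) // !nth_index ?mem_elems.
move=> i j l ij jl; rewrite size_antilex => lZ.
have [x0 _] : exists x0, x0 \in Z by apply/card_gt0P; apply: leq_ltn_trans lZ.
have jZ := ltn_trans jl lZ; have iZ := ltn_trans ij jZ.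
have [aZ bZ ab] := nth_elems_lt x0 ij jZ; have [_ cZ bc] := nth_elems_lt x0 jl lZ.
by rewrite !(antilex_nth x0) //; apply: pat.
Qed.

(** Closure under the generating relations gives closure under [Ple]. For [Z] of a size other than
    [m + 1], no deletion lies in [R], so the clauses of [coherent] hold trivially there. *)
Lemma consistentP m R :
  reflect [/\ forall X, X \in R -> Inv w m X & coherent w setT R] (consistent w m R).
Proof.
apply: (iffP and3P) => [[/forallP h1 /forallP h2 /forallP h3]|[h1 [L P]]].
  have {}h1 X : X \in R -> Inv w m X by apply/implyP.
  split=> //; split.
    move=> Z x y X Y _ q ar YR.
    have := h2 Y => /forallP/(_ X)/implyP; apply.
    have qr : qrel w m X Y.
      apply/qrelP; exists Z, x, y; split=> //.
      have [xZ yZ _ _ _] := q; have [cY _] := InvP _ _ (h1 _ YR).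
      move: ar cY; case: odd => -[_ ->] cY.
        by have := cardsD1 y Z; rewrite yZ cY.
      by have := cardsD1 x Z; rewrite xZ cY.
    by rewrite YR (qrel_Inv qr).1 /Ple connect1.
  move=> Z a b c _ iZ aZ bZ cZ ab bc e.
  have [cardZ|cardZ] := eqVneq #|Z| m.+1.
    have invZ : Inv w m.+1 Z by apply/InvP.
    have /prefix_or_suffix_packetP pat := implyP (h3 Z) invZ.
    exact: pat e.
  have no z : z \in Z -> (Z :\ z \in R) = false.
    move=> zZ; apply/negP=> /h1/InvP[cz _].
    by have := cardsD1 z Z; rewrite zZ cz; move/eqP: cardZ.
  by rewrite !no.
split.
- by apply/forallP=> X; apply/implyP; apply: h1.
- apply/forallP=> X; apply/forallP=> Y; apply/implyP=> /and3P[+ _ /connectP[p]].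
  elim: p Y => [|Y' p IH] Y /=; first by move=> XR _ <-.
  move=> XR /andP[q pth] e; have := IH Y' XR pth e.
  by case/qrelP: q => Z [x [y [_ q ar]]]; apply: L q ar; apply: subsetT.
apply/forallP=> Z; apply/implyP=> /Inv_inversions iZ.
by apply/prefix_or_suffix_packetP=> a b c; apply: P => //; apply: subsetT.
Qed.

End Packets.

(** * Total orders and their restrictions to packets *)

Section Orders.
Variables (n : nat) (w : {perm 'I_n}) (k : nat).
Local Notation T := {set 'I_n}.
Implicit Types (U V W X Y Z : T) (x y z a b c : 'I_n) (R : {set T}) (rho sigma : seq T).

Definition before rho X Y := index X rho < index Y rho.

Lemma before_trans rho : transitive (before rho).
Proof. by move=> ? ? ?; apply: ltn_trans. Qed.

Lemma before_irr rho : irreflexive (before rho).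
Proof. by move=> X; rewrite /before ltnn. Qed.

Lemma respectsP (le : rel T) rho : uniq rho ->
  respects le rho <-> pairwise (fun X Y => ~~ le Y X) rho.
Proof.
move=> u; split=> [res|/(pairwiseP set0) pw X Y Xr Yr leXY].
  apply/(pairwiseP set0) => i j il jl ij; apply/negP => /res.
  by rewrite !mem_nth // !index_uniq // => /(_ isT isT); rewrite leqNgt ij.
rewrite leqNgt; apply/negP=> /pw; rewrite !inE !index_mem => /(_ Yr Xr).
by rewrite !nth_index // leXY.
Qed.

Lemma restr_sorted rho X : uniq rho -> sorted (before rho) (restr rho X).
Proof.
by move=> u; apply: sorted_filter; [exact: before_trans | exact: sorted_index].
Qed.

Lemma antilex_sortedP (r : rel T) Z : transitive r ->
  reflect (forall a b, a \in Z -> b \in Z -> a < b -> r (Z :\ a) (Z :\ b))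
    (sorted r (antilex Z)).
Proof.
move=> tr; rewrite antilexE sorted_map; apply: (iffP idP) => [so a b aZ bZ|h].
  rewrite -(index_elems aZ bZ).
  have tr' : transitive (relpre (fun x => Z :\ x) r) by move=> ? ? ?; apply: tr.
  by apply: (sorted_ltn_index tr' so); rewrite mem_elems.
apply: (@sub_in_sorted _ [in Z] (fun a b : 'I_n => a < b)) (elems_sorted Z).
  by move=> a b aX bX; apply: h.
by apply/allP=> a; rewrite mem_elems.
Qed.

(** Two lists with the same members, both sorted for the strict order [before rho], are equal. *)
Lemma restr_antilex rho Z : uniq rho -> {subset antilex Z <= rho} ->
  restr rho Z = antilex Z <->
  forall a b, a \in Z -> b \in Z -> a < b -> before rho (Z :\ a) (Z :\ b).
Proof.
move=> u sub; split=> [e|h].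
  by apply/(antilex_sortedP _ (@before_trans rho)); rewrite -e restr_sorted.
apply: (irr_sorted_eq (@before_trans rho) (before_irr rho)).
- exact: restr_sorted.
- exact/(antilex_sortedP _ (@before_trans rho)).
by move=> Y; rewrite mem_filter; apply/andP/idP=> [[]//|YZ]; split=> //; apply: sub.
Qed.

Lemma restr_lex rho Z : uniq rho -> {subset antilex Z <= rho} ->
  restr rho Z = lex Z <->
  forall a b, a \in Z -> b \in Z -> a < b -> before rho (Z :\ b) (Z :\ a).
Proof.
move=> u sub; pose r X Y := before rho Y X.
have tr : transitive r by move=> ? ? ? h1 h2; apply: before_trans h2 h1.
split=> [e|h].
  apply/(antilex_sortedP _ tr); rewrite -[sorted _ _]/(sorted (fun Y X => before rho X Y) _).
  by rewrite -rev_sorted -lexE -e restr_sorted.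
apply: (irr_sorted_eq (@before_trans rho) (before_irr rho)).
- exact: restr_sorted.
- by rewrite lexE rev_sorted; apply/(antilex_sortedP _ tr).
move=> Y; rewrite mem_filter mem_lex.
by apply/andP/idP=> [[]//|YZ]; split=> //; apply: sub.
Qed.

Lemma packet_sub rho Z : total_order_of w k rho -> Inv w k.+1 Z ->
  {subset antilex Z <= rho}.
Proof. by move=> [_ mr] iZ Y /antilexP[x xZ ->]; rewrite mr Inv_D1. Qed.

Lemma before_total rho X Y : X \in rho -> Y \in rho -> X != Y ->
  before rho X Y = ~~ before rho Y X.
Proof.
move=> Xr Yr XY; rewrite /before -leqNgt ltn_neqAle.
by case: eqP => // /(index_inj set0 Xr Yr) e; rewrite e eqxx in XY.
Qed.

(** A packet is listed in lex or antilex order, so one pair of its members decides which. *)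
Lemma Rev_before rho Z a b : Aset w k rho -> Inv w k.+1 Z ->
  a \in Z -> b \in Z -> a < b -> (Z \in Rev w k rho) = before rho (Z :\ a) (Z :\ b).
Proof.
move=> [tot _ pk] iZ aZ bZ ab; have sub := packet_sub tot iZ; have [u _] := tot.
rewrite inE iZ /=; apply/eqP/idP => [/(restr_antilex u sub)|bf]; first exact.
case: (pk _ iZ) => [/(restr_lex u sub) h|//].
by have := before_trans bf (h _ _ aZ bZ ab); rewrite before_irr.
Qed.

Lemma notin_Rev_before rho Z a b : Aset w k rho -> Inv w k.+1 Z ->
  a \in Z -> b \in Z -> a < b -> (Z \notin Rev w k rho) = before rho (Z :\ b) (Z :\ a).
Proof.
move=> A iZ aZ bZ ab; rewrite (Rev_before A iZ aZ bZ ab); have [tot _ _] := A.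
have sub := packet_sub tot iZ; rewrite -before_total ?sub ?antilex_D1 //.
by apply: contraTneq ab => /(setD1_inj bZ) ->; rewrite ltnn.
Qed.

(** * Reversal sets are consistent *)

Lemma card_D1 m Z z : z \in Z -> #|Z :\ z| = m -> #|Z| = m.+1.
Proof. by move=> zZ <-; rewrite (cardsD1 z Z) zZ. Qed.

Lemma arrow_before rho Z x y U V : Aset w k rho -> #|Z| = k.+1 -> quasi w Z x y ->
  arrow (odd (above Z y)) Z x y U V -> before rho U V.
Proof.
move=> [[u mr] rs _] cZ q ar.
have qr : qrel w k U V by apply/qrelP; exists Z, x, y.
have [iU iV] := qrel_Inv qr.
have := rs U V; rewrite !mr iU iV /Ple connect1 // => /(_ isT isT isT).
rewrite leq_eqVlt => /orP[/eqP|//]; rewrite -mr in iU; rewrite -mr in iV.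
move/(index_inj set0 iU iV) => e; have [xZ yZ _ _ _] := q.
have := quasi_neq q; case: odd ar => -[eU eV]; move: e; rewrite eU eV.
  by move/(setD1_inj xZ) => ->; rewrite eqxx.
by move/(setD1_inj yZ) => ->; rewrite eqxx.
Qed.

Lemma quasi_sub Z x y j : quasi w Z x y -> j != x -> j != y -> quasi w (Z :\ j) x y.
Proof.
move=> [xZ yZ xy wxy q] jx jy; split=> //; rewrite ?inE 1?eq_sym ?jx ?jy //.
by move=> a b /setD1P[_ aZ] /setD1P[_ bZ]; apply: q.
Qed.

Lemma above_D1 Z y j : j \in Z -> above Z y = (y < j) + above (Z :\ j) y.
Proof.
move=> jZ; rewrite /above (cardsD1 j) inE jZ; congr (_ + #|pred_of_set _|).
by apply/setP=> z; rewrite !inE andbA.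
Qed.

(* Removing any third letter [j] from a quasi-inversion [Z] of size k+2 gives a
   quasi-inversion of size k+1; its relation closes a cycle of order 3 with the
   packets of [Z :\ x] and [Z :\ y] if lower closedness fails. *)
Lemma Rev_lower rho Z x y X Y : 0 < k -> Aset w k rho -> quasi w Z x y ->
  arrow (odd (above Z y)) Z x y X Y -> Y \in Rev w k rho -> X \in Rev w k rho.
Proof.
move=> k0 A q ar YR; have [xZ yZ xy _ _] := q; have xny := quasi_neq q.
have iY : Inv w k.+1 Y by move: YR; rewrite inE => /andP[].
have cZ : #|Z| = k.+2.
  by case/InvP: iY => cY _; move: ar cY; case: odd => -[_ ->]; apply: card_D1.
have cD1 z : z \in Z -> #|Z :\ z| = k.+1.
  by move=> zZ; have := cardsD1 z Z; rewrite zZ cZ => -[].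
have iX : Inv w k.+1 (Z :\ x) by apply/InvP; rewrite cD1 //; split=> //; apply: quasi_D1l q.
have iX' : Inv w k.+1 (Z :\ y) by apply/InvP; rewrite cD1 //; split=> //; apply: quasi_D1r q.
(* A third letter exists because [#|Z| = k + 2] and [0 < k]. *)
have [j] : exists j, j \in Z :\ x :\ y.
  apply/card_gt0P; have := cardsD1 y (Z :\ x).
  by rewrite cD1 // !inE eq_sym xny yZ => -[e]; rewrite e in k0.
case/setD1P=> jy /setD1P[jx jZ].
have qj := quasi_sub q jx jy.
have bj := arrow_before A (cD1 _ jZ) qj.
have [xj yj] : x \in Z :\ j /\ y \in Z :\ j by rewrite !inE !(eq_sym _ j) jx jy.
have [jDx yDx] : j \in Z :\ x /\ y \in Z :\ x by rewrite !inE jx jZ eq_sym xny yZ.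
have [jDy xDy] : j \in Z :\ y /\ x \in Z :\ y by rewrite !inE jy jZ xny xZ.
(* Removing [j] changes the parity exactly when [j] exceeds [y]. *)
have ab := above_D1 y jZ; rewrite ab oddD oddb in ar.
have cyc U V W : before rho U V -> before rho V W -> before rho W U -> False.
  by move=> h1 h2 /(before_trans h2)/(before_trans h1); rewrite before_irr.
apply/negPn/negP=> XnR.
case: (ltnP y j) ar => [yltj|jley] ar.
  have xltj := ltn_trans xy yltj.
  move: XnR YR; case: (odd (above (Z :\ j) y)) bj ar => bj [-> ->].
    rewrite (notin_Rev_before A iX' xDy jDy) // (Rev_before A iX yDx jDx) //.
    have := bj _ _ (conj erefl erefl); rewrite (setD1C Z j x) (setD1C Z j y) (setD1C Z y x).
    by move=> h1 h2 h3; apply: cyc h1 h2 h3.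
  rewrite (notin_Rev_before A iX yDx jDx) // (Rev_before A iX' xDy jDy) //.
  have := bj _ _ (conj erefl erefl); rewrite (setD1C Z j x) (setD1C Z j y) (setD1C Z y x).
  by move=> h1 h2 h3; apply: cyc h1 h2 h3.
have jlty : j < y by move: jley; rewrite leq_eqVlt (inj_eq val_inj) (negbTE jy).
have jltx : j < x.
  rewrite ltnNge leq_eqVlt (inj_eq val_inj) eq_sym (negbTE jx) /=; apply/negP=> h.
  exact: (quasi_adjacent q jZ h).
move: XnR YR; case: (odd (above (Z :\ j) y)) bj ar => bj [-> ->].
  rewrite (notin_Rev_before A iX jDx yDx) // (Rev_before A iX' jDy xDy) //.
  have := bj _ _ (conj erefl erefl); rewrite (setD1C Z j x) (setD1C Z j y) (setD1C Z y x).
  by move=> h1 h2 h3; apply: cyc h1 h3 h2.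
rewrite (notin_Rev_before A iX' jDy xDy) // (Rev_before A iX jDx yDx) //.
have := bj _ _ (conj erefl erefl); rewrite (setD1C Z j x) (setD1C Z j y) (setD1C Z y x).
by move=> h1 h2 h3; apply: cyc h1 h3 h2.
Qed.

(** For [a < b < c] in [Z], the packets of [Z :\ a], [Z :\ b] and [Z :\ c] compare the three sets
    obtained by deleting two of these letters. If the middle packet disagreed with two equal outer
    ones, these comparisons would form a cycle. *)
Lemma Rev_consistent rho : 0 < k -> Aset w k rho -> consistent w k.+1 (Rev w k rho).
Proof.
move=> k0 A; apply/consistentP; split=> [X|]; first by rewrite inE => /andP[].
split=> [Z x y X Y _|Z a b c _ iZ aZ bZ cZ ab bc]; first exact: Rev_lower.
have [cardZ|cardZ] := eqVneq #|Z| k.+2; last first.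
  have no z : z \in Z -> (Z :\ z \in Rev w k rho) = false.
    move=> zZ; rewrite inE; apply/negP=> /andP[/InvP[cz _] _].
    by move/eqP: cardZ; apply; apply: card_D1 cz.
  by rewrite !no.
have invD z : z \in Z -> Inv w k.+1 (Z :\ z).
  by move=> zZ; apply: Inv_D1 => //; apply/InvP.
have ac := ltn_trans ab bc.
have neq x y : x < y -> (x != y) * (y != x).
  by move=> xy; rewrite (eq_sym y); split; apply: contraTneq xy => ->; rewrite ltnn.
have iaZ := invD _ aZ; have ibZ := invD _ bZ; have icZ := invD _ cZ.
have bDa : b \in Z :\ a by rewrite !inE bZ (neq _ _ ab).
have cDa : c \in Z :\ a by rewrite !inE cZ (neq _ _ ac).
have aDb : a \in Z :\ b by rewrite !inE aZ (neq _ _ ab).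
have cDb : c \in Z :\ b by rewrite !inE cZ (neq _ _ bc).
have aDc : a \in Z :\ c by rewrite !inE aZ (neq _ _ ac).
have bDc : b \in Z :\ c by rewrite !inE bZ (neq _ _ bc).
have cyc U V W : before rho U V -> before rho V W -> before rho W U -> False.
  by move=> h1 h2 /(before_trans h2)/(before_trans h1); rewrite before_irr.
case aR: (Z :\ a \in _); case bR: (Z :\ b \in _); case cR: (Z :\ c \in _) => // _.
  move/negbT: bR; move: aR cR; rewrite (notin_Rev_before A ibZ aDb cDb ac).
  rewrite (Rev_before A iaZ bDa cDa bc) (Rev_before A icZ aDc bDc ab).
  rewrite !(setD1C Z _ a) (setD1C Z c b) => h1 h2 h3; case: (cyc _ _ _ h1 h2 h3).
move/negbT: aR; move/negbT: cR; move: bR; rewrite (Rev_before A ibZ aDb cDb ac).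
rewrite (notin_Rev_before A iaZ bDa cDa bc) (notin_Rev_before A icZ aDc bDc ab).
rewrite !(setD1C Z _ a) (setD1C Z c b) => h1 h2 h3; case: (cyc _ _ _ h1 h2 h3).
Qed.

(** * Admissible orders as linear extensions of [<=_R] *)

Lemma Ple_leR R X Y : Ple w k X Y -> leR w k R X Y.
Proof.
by move: X Y; apply: connect_sub => X Y q; apply: connect1; rewrite /Gedge q.
Qed.

Lemma edge_before rho X Y : Aset w k rho -> X \in rho ->
  edge w setT (Rev w k rho) X Y -> before rho X Y /\ Y \in rho.
Proof.
move=> A Xr; have [[_ mr] _ _] := A; rewrite mr in Xr; have [cX _] := InvP _ _ _ Xr.
have card Z x y o : x \in Z -> y \in Z -> arrow o Z x y X Y -> #|Z| = k.+1.
  by move=> xZ yZ; case: o => -[eX _]; rewrite eX in cX; apply: card_D1 cX.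
case=> [Z x y _ q ar|Z x y _ iZ xZ yZ xy ar].
  have [xZ yZ _ _ _] := q; have cZ := card _ _ _ _ xZ yZ ar.
  split; first exact: (arrow_before A cZ q ar).
  have : qrel w k X Y by apply/qrelP; exists Z, x, y.
  by rewrite mr => /qrel_Inv[].
have invZ : Inv w k.+1 Z by apply/InvP; rewrite (card _ _ _ _ xZ yZ ar).
case: (boolP (Z \in _)) ar => ZR [-> ->]; rewrite mr Inv_D1 //; split=> //.
  by rewrite -(Rev_before A).
by rewrite -(notin_Rev_before A).
Qed.

Lemma Aset_lin_ext rho : Aset w k rho -> lin_ext w k (Rev w k rho) rho.
Proof.
move=> A; have [tot _ _] := A; split=> // X Y Xr _ /connectP[p].
elim: p X Xr => [|Z p IH] X Xr /=; first by move=> _ ->.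
case/andP=> /Gedge_edge/(edge_before A Xr)[b Zr] pth e.
by apply: leq_trans (IH _ Zr pth e); apply: ltnW.
Qed.

Lemma lin_ext_before R rho X Y : lin_ext w k R rho -> X \in rho -> Y \in rho ->
  X != Y -> leR w k R X Y -> before rho X Y.
Proof.
move=> [_ rs] Xr Yr XY /(rs _ _ Xr Yr); rewrite leq_eqVlt => /orP[/eqP|//].
by move/(index_inj set0 Xr Yr) => e; rewrite e eqxx in XY.
Qed.

(** The edges of [G_R] chain each packet in antilex order for members of [R] and in lex order
    otherwise. As [0 < k], packets have at least two members, so the two orders differ and [Rev]
    recovers [R]. *)
Lemma lin_ext_Aset R rho : 0 < k -> (forall X, X \in R -> Inv w k.+1 X) ->
  lin_ext w k R rho -> Aset w k rho /\ Rev w k rho = R.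
Proof.
move=> k0 RI L; have [tot rs] := L; have [u mr] := tot.
have pk Z : Inv w k.+1 Z -> restr rho Z = if Z \in R then antilex Z else lex Z.
  move=> iZ; have sub := packet_sub tot iZ.
  have bf a b : a \in Z -> b \in Z -> a < b ->
      if Z \in R then before rho (Z :\ a) (Z :\ b) else before rho (Z :\ b) (Z :\ a).
    move=> aZ bZ ab; have ne : Z :\ a != Z :\ b.
      by apply: contraTneq ab => /(setD1_inj aZ) ->; rewrite ltnn.
    case: (boolP (Z \in R)) => ZR.
      apply: (lin_ext_before L); rewrite ?sub ?antilex_D1 //.
      by apply: (leR_packet iZ aZ bZ ab); rewrite /arrow ZR.
    apply: (lin_ext_before L); rewrite ?sub ?antilex_D1 1?eq_sym //.
    by apply: (leR_packet iZ aZ bZ ab); rewrite /arrow (negbTE ZR).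
  by case: (Z \in R) bf => bf; [apply/restr_antilex|apply/restr_lex].
split; last first.
  apply/setP=> Z; rewrite inE; case iZ: (Inv w k.+1 Z) => /=; last first.
    by apply/esym/negbTE/negP=> /RI; rewrite iZ.
  rewrite pk //; case: (Z \in R); rewrite ?eqxx //.
  by apply/negbTE/lex_antilex; have [-> _] := InvP _ _ _ iZ.
split=> // [X Y Xr Yr /Ple_leR h|Z iZ]; first exact: rs.
by rewrite pk //; case: (_ \in _); [right|left].
Qed.

Lemma lin_ext_pairwise R rho : lin_ext w k R rho <->
  total_order_of w k rho /\ pairwise (fun X Y => ~~ leR w k R Y X) rho.
Proof.
by split=> -[tot h]; split=> //; have [u _] := tot; apply/(respectsP _ u).
Qed.

(** * Commutation classes *)

Lemma total_order_perm rho sigma : perm_eq rho sigma ->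
  total_order_of w k rho -> total_order_of w k sigma.
Proof.
move=> p [u m]; split=> [|X]; first by rewrite -(perm_uniq p).
by rewrite -(perm_mem p).
Qed.

(** Members [X = Z :\ a] and [Y = Z :\ b] of a common packet are comparable: every pair of [Z] other
    than [(a, b)] survives in [X] or in [Y], so [Z] is an inversion set or a quasi-inversion, and
    either one orders [X] and [Y]. *)
Lemma incomparable_commuting R X Y : Inv w k X -> Inv w k Y ->
  ~~ leR w k R X Y -> ~~ leR w k R Y X -> commuting w k X Y.
Proof.
move=> iX iY nXY nYX; apply/and3P; split.
- by apply: contra nXY; apply: Ple_leR.
- by apply: contra nYX; apply: Ple_leR.
apply/existsP=> -[Z /and3P[/eqP cZ /antilexP[a aZ eX] /antilexP[b bZ eY]]].
wlog ab : a b X Y iX iY nXY nYX aZ bZ eX eY / a < b.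
  move=> H; case: (ltngtP a b) => [ab|ba|/val_inj ab].
  - exact: (H a b X Y).
  - exact: (H b a Y X).
  - by rewrite eX eY ab /leR connect0 in nXY.
have inv c d : c \in Z -> d \in Z -> c < d -> (c, d) != (a, b) -> winv w d < winv w c.
  move=> cZ' dZ cd ne.
  have [/andP[ca da]|] := boolP ((c != a) && (d != a)).
    by apply: (Inv_inversions iX); rewrite ?eX ?inE ?ca ?da ?cZ' ?dZ.
  have [/andP[cb db] _|] := boolP ((c != b) && (d != b)).
    by apply: (Inv_inversions iY); rewrite ?eY ?inE ?cb ?db ?cZ' ?dZ.
  rewrite !negb_and !negbK => /orP[]/eqP h1 /orP[]/eqP h2; subst.
  - by rewrite ltnn in ab.
  - by have := ltn_trans ab cd; rewrite ltnn.
  - by rewrite eqxx in ne.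
  - by rewrite ltnn in ab.
have [wba|wab] := ltnP (winv w b) (winv w a).
  have iZ : Inv w k.+1 Z.
    apply/InvP; split=> // c d cZ' dZ cd.
    by have [[-> ->]//|] := eqVneq (c, d) (a, b); apply: inv.
  have := leR_packet iZ aZ bZ ab; case ZR: (Z \in R) => /(_ R); rewrite ZR.
    by move/(_ _ _ (conj eX eY)); apply/negP.
  by move/(_ _ _ (conj eY eX)); apply/negP.
have q : quasi w Z a b.
  split=> //; rewrite ltn_neqAle wab andbT; apply: contraTneq ab => /winv_inj ->.
  by rewrite ltnn.
have : qrel w k X Y || qrel w k Y X.
  case o: (odd (above Z b)); apply/orP; [left|right]; apply/qrelP;
  by exists Z, a, b; rewrite o.
by case/orP=> q'; [case/negP: nXY|case/negP: nYX]; apply: connect1; rewrite /Gedge q'.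
Qed.

(** Commuting sets share no packet, so no restriction sees their swap. *)
Lemma comm_step_Rev rho sigma : comm_step w k rho sigma -> Rev w k rho = Rev w k sigma.
Proof.
case=> s1 [s2 [X [Y [/and3P[_ _ nZ] -> ->]]]]; apply/setP=> Z; rewrite !inE.
case iZ: (Inv w k.+1 Z) => //=; congr (_ == _).
rewrite /restr !filter_cat /=; congr (_ ++ _).
have : ~~ ((X \in antilex Z) && (Y \in antilex Z)).
  apply: contra nZ => XY; apply/existsP; exists Z.
  by rewrite XY; have [-> _] := InvP _ _ _ iZ; rewrite eqxx.
by case: (X \in _); case: (Y \in _).
Qed.

Lemma comm_equiv_Rev rho sigma : comm_equiv w k rho sigma -> Rev w k rho = Rev w k sigma.
Proof.
elim=> // [{}rho {}sigma [_ _ /comm_step_Rev]//|r s t _ -> _ ->//].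
Qed.

(** Each intermediate list is again a linear extension of [<=_R], so the chain stays inside [Aset],
    as commutation steps require. *)
Lemma lin_ext_swaps R rho sigma : 0 < k -> (forall X, X \in R -> Inv w k.+1 X) ->
  lin_ext w k R rho -> lin_ext w k R sigma ->
  clos_refl_trans _ (fun rho sigma => [/\ Aset w k rho, Aset w k sigma
    & comm_step w k rho sigma]) rho sigma.
Proof.
move=> k0 RI L L'; have [[u m] pr] := (lin_ext_pairwise R rho).1 L.
have [[u' m'] ps] := (lin_ext_pairwise R sigma).1 L'.
have pe : perm_eq rho sigma by apply: uniq_perm => // X; rewrite m m'.
have cl := clos_rt_rt1n _ _ _ _ (ext_connected pe pr ps).
elim: cl L {u m pr L' u' m' ps pe} => [s _|r s t sw _ IH Lr]; first exact: rt_refl.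
have [totr pr] := (lin_ext_pairwise R r).1 Lr.
have Ls : lin_ext w k R s.
  apply/lin_ext_pairwise; split; first exact: total_order_perm (swap_perm sw) totr.
  exact: swap_ext sw pr.
apply: rt_trans (IH Ls); apply: rt_step; split.
- exact: (lin_ext_Aset k0 RI Lr).1.
- exact: (lin_ext_Aset k0 RI Ls).1.
case: sw => s1 s2 X Y nXY nYX er es; exists s1, s2, X, Y; split=> //.
have [_ m] := totr.
by apply: incomparable_commuting nXY nYX; rewrite -m er mem_cat !inE eqxx ?orbT.
Qed.

Lemma same_Rev_comm_equiv rho sigma : 0 < k -> Aset w k rho -> Aset w k sigma ->
  Rev w k rho = Rev w k sigma -> comm_equiv w k rho sigma.
Proof.
move=> k0 A B e; have L := Aset_lin_ext B; rewrite -e in L.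
have RI X : X \in Rev w k rho -> Inv w k.+1 X by rewrite inE => /andP[].
exact: clos_rt_clos_rst (lin_ext_swaps k0 RI (Aset_lin_ext A) L).
Qed.

(** * Existence of linear extensions *)

Lemma rank_lin_ext R (f : T -> nat) rho :
  (forall X Y, Gedge w k R X Y -> f X < f Y) -> total_order_of w k rho ->
  pairwise (fun X Y => f X <= f Y) rho -> lin_ext w k R rho.
Proof.
move=> fP tot pw; apply/lin_ext_pairwise; split=> //.
have [u _] := tot; rewrite uniq_pairwise in u.
have : pairwise (fun X Y => (X != Y) && (f X <= f Y)) rho.
  by rewrite (@pairwise_relI _ (fun X Y => X != Y)) u pw.
(* A nonempty path raises [f] strictly, so sets of equal rank may come in either order. *)
apply: sub_pairwise => X Y /andP[XY fXY]; apply/negP=> /connectP[[|Z p] /=].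
  by move=> _ e; rewrite e eqxx in XY.
case/andP=> /fP fYZ pth e; have : f Z <= f X.
  elim: p Z pth e {fYZ} => [|Z' p IH] Z /=; first by move=> _ ->.
  by case/andP=> /fP/ltnW le pth e; apply: leq_trans le (IH _ pth e).
by move=> fZX; have := leq_trans (leq_trans fYZ fZX) fXY; rewrite ltnn.
Qed.

Lemma consistent_rank R : consistent w k.+1 R ->
  exists f : T -> nat, forall X Y, Gedge w k R X Y -> f X < f Y.
Proof.
case/consistentP=> _ /coherent_rank[f fP]; exists f => X Y /Gedge_edge; exact: fP.
Qed.

Lemma sort_rank_pairwise (f : T -> nat) (s : seq T) :
  pairwise (fun X Y => f X <= f Y) (sort (fun X Y => f X <= f Y) s).
Proof.
rewrite -sorted_pairwise; first by apply: sort_sorted => X Y; exact: leq_total.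
by move=> X Y Z; apply: leq_trans.
Qed.

Lemma consistent_lin_ext R : consistent w k.+1 R -> exists rho, lin_ext w k R rho.
Proof.
case/consistent_rank=> f fP.
exists (sort (fun X Y => f X <= f Y) (enum (Inv w k))).
apply: (rank_lin_ext fP); last exact: sort_rank_pairwise.
by split=> [|X]; rewrite ?sort_uniq ?enum_uniq // mem_sort mem_enum.
Qed.

(** * Packet flips and reversal sets *)

Lemma flip_restr s1 s2 X Z : X != Z ->
  restr (s1 ++ lex X ++ s2) Z = restr (s1 ++ antilex X ++ s2) Z.
Proof.
move=> XZ; rewrite /restr !filter_cat lexE filter_rev; congr (_ ++ (_ ++ _)).
have : uniq [seq Y <- antilex X | Y \in antilex Z] by rewrite filter_uniq ?antilex_uniq.
have sub Y : Y \in [seq Y <- antilex X | Y \in antilex Z] ->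
    (Y \in antilex Z) && (Y \in antilex X) by rewrite mem_filter.
(* Distinct packets share at most one set, so the common part equals its reversal. *)
case: [seq _ <- _ | _] sub => [|U [|V s]] //= sub; rewrite inE negb_or.
case/andP=> /andP[UV _] _; have := sub U; have := sub V; rewrite !inE !eqxx orbT.
move=> /(_ isT)/andP[V1 V2] /(_ isT)/andP[U1 U2].
by rewrite (packet_meet UV U2 V2 U1 V1) eqxx in XZ.
Qed.

(** The restriction has [#|X|] entries and the block already supplies that many. *)
Lemma restr_block s1 s2 s X : Aset w k (s1 ++ s ++ s2) -> Inv w k.+1 X ->
  perm_eq s (antilex X) -> restr (s1 ++ s ++ s2) X = s.
Proof.
move=> [_ _ pk] iX pe.
have szr : size (restr (s1 ++ s ++ s2) X) = #|X|.
  by case: (pk X iX) => ->; rewrite ?lexE ?size_rev size_antilex.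
have fs : [seq Y <- s | Y \in antilex X] = s.
  by apply/all_filterP/allP=> Y; rewrite (perm_mem pe).
move: szr; rewrite /restr !filter_cat fs !size_cat (perm_size pe) size_antilex => /eqP.
rewrite addnCA -[X in _ == X]addn0 eqn_add2l addn_eq0 => /andP[/nilP -> /nilP ->].
by rewrite cats0.
Qed.

(** Only the restriction to the packet of [X] changes, from lex to antilex, so exactly [X] is
    added. *)
Lemma flip_Cstep rho sigma : 0 < k -> Aset w k rho -> Aset w k sigma ->
  flip_step w k rho sigma -> C_step w k.+1 (Rev w k rho) (Rev w k sigma).
Proof.
move=> k0 A B [s1 [s2 [X [iX er es]]]]; rewrite /C_step !Rev_consistent //=.
have XnR : X \notin Rev w k rho.
  rewrite inE iX /= er restr_block -?er //; last by rewrite lexE perm_rev.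
  by apply: lex_antilex; have [-> _] := InvP _ _ _ iX.
have -> : Rev w k sigma = X |: Rev w k rho.
  apply/setP=> Z; rewrite !inE; have [->|ZX] := eqVneq Z X.
    by rewrite iX /= es restr_block -?es ?eqxx.
  by rewrite er es flip_restr // eq_sym.
rewrite setDUl setDv setU0 setDE; apply/andP; split.
  rewrite properE subsetUr; apply/subsetPn; exists X => //; exact: setU11.
apply/cards1P; exists X; apply/setIidPl; rewrite subsetC.
by apply/subsetP=> Y YR; rewrite !inE; apply: contraTneq YR => ->.
Qed.

Lemma Ble_Cle rho sigma : 0 < k -> Ble w k rho sigma ->
  Cle w k.+1 (Rev w k rho) (Rev w k sigma).
Proof.
move=> k0; elim=> [r s [A B [/comm_step_Rev ->|fl]]|r|r s t _ h1 _ h2].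
- exact: connect0.
- by apply: connect1; apply: flip_Cstep.
- exact: connect0.
- exact: connect_trans h2.
Qed.

(** * A packet as a block of a linear extension *)

Lemma del_antilex X i : 0 < i -> i <= #|X| -> del X i \in antilex X.
Proof. by move=> i0 iX; rewrite /antilex map_f // mem_iota i0 add1n ltnS. Qed.

Lemma Gedge_off_packet R R' X Y Y' : (forall Z, Z != X -> (Z \in R) = (Z \in R')) ->
  ~~ ((Y \in antilex X) && (Y' \in antilex X)) -> Gedge w k R Y Y' -> Gedge w k R' Y Y'.
Proof.
move=> RR' off /orP[q|/existsP[Z /existsP[i /and3P[iZ i0 h]]]]; first by rewrite /Gedge q.
apply/orP; right; apply/existsP; exists Z; apply/existsP; exists i; rewrite iZ i0 /=.
have [ZX|ZX] := eqVneq Z X; last by rewrite -RR'.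
have [cX _] := InvP _ _ _ iZ.
have d1 : del Z i \in antilex Z by rewrite del_antilex // cX ltnW.
have d2 : del Z i.+1 \in antilex Z by rewrite del_antilex // cX.
case/negP: off; rewrite -ZX.
by case/orP: h => /andP[/andP[_ /eqP ->] /eqP ->]; rewrite d1 d2.
Qed.

Lemma connect_rank (e : rel T) (f : T -> nat) Y Y' :
  (forall U V, e U V -> f U < f V) -> connect e Y Y' -> f Y <= f Y'.
Proof.
move=> fe /connectP[p]; elim: p Y => [|Z p IH] Y /=; first by move=> _ ->.
by case/andP=> /fe/ltnW le pth eq; apply: leq_trans le (IH _ pth eq).
Qed.

(* The relations of [G_R] and [G_R'] differ only by the direction of the chain on
   the packet of [X]. A path leaving the packet and coming back would thus go
   strictly up for ranks of both graphs, but these order the packet oppositely. *)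
Lemma packet_consecutive R X : consistent w k.+1 R -> consistent w k.+1 (X |: R) ->
  X \notin R -> exists s1 s2, lin_ext w k R (s1 ++ lex X ++ s2)
    /\ lin_ext w k (X |: R) (s1 ++ antilex X ++ s2).
Proof.
move=> /consistentP[_ /coherent_rank[f fP]] /consistentP[RI /coherent_rank[f' fP']] XnR.
have iX : Inv w k.+1 X by apply: RI; rewrite setU11.
have iXi := Inv_inversions iX.
have XR : X \in X |: R by rewrite setU11.
have RR' Z : Z != X -> (Z \in R) = (Z \in X |: R).
  by move=> /negbTE ZX; rewrite !inE ZX.
pose P Y := Y \in antilex X.
(* [H] drops the edges inside the packet; [D] collects the sets outside the packet from which [H]
   leads into it. *)
pose H Y Y' := Gedge w k R Y Y' && ~~ (P Y && P Y').
pose D Y := ~~ P Y && [exists b, P b && connect H Y b].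
have Hf Y Y' : H Y Y' -> f Y < f Y' by case/andP=> /Gedge_edge/fP.
have Hf' Y Y' : H Y Y' -> f' Y < f' Y'.
  by case/andP=> h off; apply/fP'/Gedge_edge/(Gedge_off_packet RR' off h).
have fX a b : a \in X -> b \in X -> a < b -> f (X :\ b) < f (X :\ a).
  move=> aX bX ab; apply: fP; apply: (EdgeInv _ iXi aX bX ab); first exact: subsetT.
  by rewrite /arrow (negbTE XnR).
have fX' a b : a \in X -> b \in X -> a < b -> f' (X :\ a) < f' (X :\ b).
  move=> aX bX ab; apply: fP'; apply: (EdgeInv _ iXi aX bX ab); first exact: subsetT.
  by rewrite /arrow XR.
have noreturn Y Y' : P Y -> H Y Y' -> ~~ D Y'.
  move=> PY h; apply/negP=> /andP[_ /existsP[V /andP[PV c]]].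
  have l1 := leq_trans (Hf _ _ h) (connect_rank Hf c).
  have l2 := leq_trans (Hf' _ _ h) (connect_rank Hf' c).
  case/antilexP: PY => a aX eY; case/antilexP: PV => b bX eV; subst Y V.
  case: (ltngtP a b) => [ab|ba|/val_inj ab].
  - by have := ltn_trans l1 (fX _ _ aX bX ab); rewrite ltnn.
  - by have := ltn_trans l2 (fX' _ _ bX aX ba); rewrite ltnn.
  - by rewrite ab ltnn in l1.
have [A fA] := bounded f; have [B fB] := bounded f'.
(* [D] is ranked below [A], the packet in [A .. 2A + B - 1], the rest from [2A + B] on. The bound
   [A + B] on [h] suits both choices [f] and [f']. *)
pose g (h : T -> nat) Y := if P Y then A + h Y else if D Y then f Y else A + A + B + f Y.
have grank h R0 : (forall Y, h Y < A + B) ->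
    (forall Y Y', Gedge w k R0 Y Y' -> P Y -> P Y' -> h Y < h Y') ->
    (forall Y Y', Gedge w k R0 Y Y' -> ~~ (P Y && P Y') -> H Y Y') ->
    forall Y Y', Gedge w k R0 Y Y' -> g h Y < g h Y'.
  move=> hb hP hH Y Y' e; rewrite /g.
  have [PY|nPY] := boolP (P Y).
    have [PY'|nPY'] := boolP (P Y'); first by rewrite ltn_add2l hP.
    have h1 : H Y Y' by apply: hH => //; rewrite negb_and nPY' orbT.
    by rewrite (negbTE (noreturn _ _ PY h1)); have := hb Y; lia.
  have h1 : H Y Y' by apply: hH => //; rewrite negb_and nPY.
  have := Hf _ _ h1; have := fA Y; have [PY'|nPY'] := boolP (P Y').
    have -> : D Y by rewrite /D nPY; apply/existsP; exists Y'; rewrite PY' connect1.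
    by lia.
  have [DY'|nDY'] := boolP (D Y').
    have -> // : D Y.
    case/andP: DY' => _ /existsP[b /andP[Pb c]]; rewrite /D nPY; apply/existsP; exists b.
    by rewrite Pb (connect_trans (connect1 h1)).
  by case: (D Y); lia.
(* Both outer lists are sorted by [f], whichever [h] ranks the packet, so the two linear extensions
   share them. *)
pose s1 := sort (fun Y Z => f Y <= f Z) [seq Y <- enum (Inv w k) | D Y].
pose s2 := sort (fun Y Z => f Y <= f Z) [seq Y <- enum (Inv w k) | ~~ P Y && ~~ D Y].
have m1 Y : (Y \in s1) = D Y && Inv w k Y by rewrite mem_sort mem_filter mem_enum.
have m2 Y : (Y \in s2) = [&& ~~ P Y, ~~ D Y & Inv w k Y].
  by rewrite mem_sort mem_filter mem_enum andbA.
have DnP Y : D Y -> ~~ P Y by case/andP.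
have tot s : perm_eq s (antilex X) -> total_order_of w k (s1 ++ s ++ s2).
  move=> pe; split=> [|Y]; last first.
    rewrite !mem_cat m1 m2 (perm_mem pe) -/(P Y).
    have := DnP Y; case: (D Y) => [/(_ isT)/negbTE ->|_]; rewrite ?orbF //=.
    case PY: (P Y) => //=; move/antilexP: PY => [x xX ->].
    by rewrite Inv_D1.
  have u1 : uniq s1 by rewrite sort_uniq; apply: filter_uniq; exact: enum_uniq.
  have u2 : uniq s2 by rewrite sort_uniq; apply: filter_uniq; exact: enum_uniq.
  rewrite !cat_uniq u1 u2 (perm_uniq pe) antilex_uniq.
  rewrite /= !andbT; apply/andP; split; apply/hasP=> -[Y].
    rewrite mem_cat (perm_mem pe) -/(P Y) /= m1 m2 => h /andP[DY _].
    by move: h; rewrite (negbTE (DnP _ DY)) DY.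
  by rewrite /= m2 (perm_mem pe) -/(P Y) => /and3P[/negP].
have ext h R0 s : (forall Y, h Y < A + B) ->
    (forall Y Y', Gedge w k R0 Y Y' -> P Y -> P Y' -> h Y < h Y') ->
    (forall Y Y', Gedge w k R0 Y Y' -> ~~ (P Y && P Y') -> H Y Y') ->
    perm_eq s (antilex X) -> sorted (fun U V => h U < h V) s ->
    lin_ext w k R0 (s1 ++ s ++ s2).
  move=> hb hP hH pe so; apply: (rank_lin_ext (grank h R0 hb hP hH)); first exact: tot.
  have tr : transitive (fun U V => h U < h V) by move=> ? ? ?; apply: ltn_trans.
  have gs Y : Y \in s -> g h Y = A + h Y by rewrite (perm_mem pe) /g /P => ->.
  have g1 Y : Y \in s1 -> g h Y = f Y.
    by rewrite m1 /g => /andP[DY _]; rewrite (negbTE (DnP _ DY)) DY.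
  have g2 Y : Y \in s2 -> g h Y = A + A + B + f Y.
    by rewrite m2 /g => /and3P[/negbTE -> /negbTE ->].
  have shift d (q : T -> nat) s0 : (forall Y, Y \in s0 -> g h Y = d + q Y) ->
      pairwise (fun U V => q U <= q V) s0 -> pairwise (fun U V => g h U <= g h V) s0.
    move=> gq /(pairwiseP set0) pw; apply/(pairwiseP set0) => i j il jl ij.
    by rewrite !gq ?mem_nth // leq_add2l; apply: pw.
  rewrite !pairwise_cat; apply/and3P; split; last (apply/and3P; split).
  - apply/allrelP=> U V Us1; rewrite mem_cat (g1 _ Us1) => /orP[] Vs.
      by rewrite gs //; have := fA U; lia.
    by rewrite g2 //; have := fA U; lia.
  - by apply: (shift 0 f) => //; apply: sort_rank_pairwise.
  - by apply/allrelP=> U V Us Vs; rewrite gs // g2 //; have := hb U; lia.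
  - apply: (shift A h) => //; rewrite (sorted_pairwise tr) in so.
    by apply: sub_pairwise so => U V; apply: ltnW.
  by apply: (shift (A + A + B) f) => //; apply: sort_rank_pairwise.
exists s1, s2; split.
  apply: (ext f) => [Y|Y Y' e _ _|Y Y' e off||]; rewrite ?lexE ?perm_rev //.
  - by have := fA Y; lia.
  - by apply: fP; apply: Gedge_edge e.
  - by rewrite /H e off.
  - rewrite rev_sorted; apply/antilex_sortedP; last exact: fX.
    by move=> ? ? ? h1 h2; apply: ltn_trans h2 h1.
apply: (ext f') => [Y|Y Y' e _ _|Y Y' e off||] //.
- by have := fB Y; lia.
- by apply: fP'; apply: Gedge_edge e.
- rewrite /H off andbT; apply: Gedge_off_packet off e => Z ZX.
  by rewrite RR'.
- apply/antilex_sortedP; last exact: fX'.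
  by move=> ? ? ?; apply: ltn_trans.
Qed.

(** * From chains of consistent sets back to flips *)

Lemma comm_rt_Ble rho sigma :
  clos_refl_trans _ (fun rho sigma => [/\ Aset w k rho, Aset w k sigma
    & comm_step w k rho sigma]) rho sigma -> Ble w k rho sigma.
Proof.
elim=> [r s [A B c]|r|r s t _ h1 _ h2]; [|exact: rt_refl|exact: rt_trans h2].
by apply: rt_step; split=> //; left.
Qed.

Lemma same_Rev_Ble rho sigma : 0 < k -> Aset w k rho -> Aset w k sigma ->
  Rev w k rho = Rev w k sigma -> Ble w k rho sigma.
Proof.
move=> k0 A B e; apply: comm_rt_Ble; have L := Aset_lin_ext B; rewrite -e in L.
apply: lin_ext_swaps k0 _ (Aset_lin_ext A) L => X.
by rewrite inE => /andP[].
Qed.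

(** Induction on the chain: for each added [X], commutations make its packet a block, and one flip
    then adds [X] to the reversal set. *)
Lemma Cle_Ble rho sigma : 0 < k -> Aset w k rho -> Aset w k sigma ->
  Cle w k.+1 (Rev w k rho) (Rev w k sigma) -> Ble w k rho sigma.
Proof.
move=> k0 A B /connectP[p]; elim: p rho A => [|R p IH] rho A /=.
  by move=> _ e; apply: same_Rev_Ble.
case/andP=> /and4P[c1 c2 pr /cards1P[X eX]] pth e.
have [XR XnR] : X \in R /\ X \notin Rev w k rho.
  by have : X \in R :\: Rev w k rho by [rewrite eX set11]; rewrite inE => /andP[].
have eR : R = X |: Rev w k rho.
  by rewrite -eX setDE setUIl (setUC (~: _)) setUCr setIT; apply/esym/setUidPl/proper_sub.
rewrite eR in c2; have [s1 [s2 [L1 L2]]] := packet_consecutive c1 c2 XnR.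
have RI R0 : consistent w k.+1 R0 -> forall Y, Y \in R0 -> Inv w k.+1 Y by case/consistentP.
have [A1 e1] := lin_ext_Aset k0 (RI _ c1) L1.
have [A2 e2] := lin_ext_Aset k0 (RI _ c2) L2.
apply: rt_trans (same_Rev_Ble k0 A A1 (esym e1)) _.
apply: rt_trans (IH _ A2 _ _); rewrite ?e2 -?eR //.
apply: rt_step; split=> //; right; exists s1, s2, X; split=> //.
exact: (RI _ c2 X (setU11 _ _)).
Qed.

End Orders.

Theorem theorem3p12 (n k : nat) (w : {perm 'I_n}) :
  (0 < n)%N -> (1 <= k <= n)%N ->
  ([/\ (* well-defined on classes *)
      (forall rho sigma, Aset w k rho -> Aset w k sigma ->
         comm_equiv w k rho sigma -> Rev w k rho = Rev w k sigma),
      (* lands in C_w(n,k+1) *)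
      (forall rho, Aset w k rho -> consistent w k.+1 (Rev w k rho)),
      (* injective on classes *)
      (forall rho sigma, Aset w k rho -> Aset w k sigma ->
         Rev w k rho = Rev w k sigma -> comm_equiv w k rho sigma) &
      (* surjective *)
      (forall R, consistent w k.+1 R -> exists rho, Aset w k rho /\ Rev w k rho = R)]
   /\ (
      (* order isomorphism *)
      (forall rho sigma, Aset w k rho -> Aset w k sigma ->
         (Ble w k rho sigma <-> Cle w k.+1 (Rev w k rho) (Rev w k sigma))) /\
      (* inverse: R |-> linear extensions of <=_R, a single commutation class *)
      (forall R, consistent w k.+1 R ->
         (forall sigma, lin_ext w k R sigma <-> (Aset w k sigma /\ Rev w k sigma = R)) /\
         exists rho, lin_ext w k R rho /\
           forall sigma, lin_ext w k R sigma <-> (Aset w k sigma /\ comm_equiv w k rho sigma)))).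
Proof.
move=> _ /andP[k0 _].
(* Surjectivity and the description of the inverse both rest on this equivalence. *)
have linP R sigma : consistent w k.+1 R ->
    lin_ext w k R sigma <-> (Aset w k sigma /\ Rev w k sigma = R).
  case/consistentP=> RI _; split=> [|[A <-]]; first exact: lin_ext_Aset.
  exact: Aset_lin_ext.
split; first split.
- by move=> rho sigma _ _; apply: comm_equiv_Rev.
- by move=> rho; apply: Rev_consistent.
- by move=> rho sigma; apply: same_Rev_comm_equiv.
- move=> R cR; have [rho L] := consistent_lin_ext cR.
  by exists rho; apply/linP.
split=> [rho sigma A B|R cR]; first by split; [exact: Ble_Cle | exact: Cle_Ble].
split=> [sigma|]; first exact: linP.
have [rho L] := consistent_lin_ext cR; have [A eR] := (linP _ rho cR).1 L.
exists rho; split=> // sigma; split=> [/(linP _ _ cR)[B e]|[B ce]].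
  by split=> //; apply: same_Rev_comm_equiv => //; rewrite eR.
by apply/linP=> //; split=> //; rewrite -(comm_equiv_Rev ce).
Qed.
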